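(* Let $d\ge1$ be an integer and $0<\alpha<2$, and let $p$ be the transition density on $\mathbb{R}^d$ of the fractional Laplacian $\Delta^{\alpha/2}$. Then the parabolic Kato class for $p$ equals the relative Kato class for $p$; that is, a Borel measurable function $q:\mathbb{R}\times\mathbb{R}^d\to\mathbb{R}$ belongs to the parabolic Kato class for $p$ if and only if $q$ is relatively Kato with respect to $p$ and Lebesgue measure.
   Context: The transition density of $\Delta^{\alpha/2}=-(-\Delta)^{\alpha/2}$ is $p(s,x,t,y)=p_{t-s}(y-x)$ for $s<t$, $x,y\in\mathbb{R}^d$, and $p(s,x,t,y)=0$ for $s\ge t$, where for $t>0$, $p_t$ is the smooth real-valued function on $\mathbb{R}^d$ determined by $\int_{\mathbb{R}^d}p_t(z)e^{iz\cdot\xi}\,dz=e^{-t|\xi|^\alpha}$, $\xi\in\mathbb{R}^d$. Here $dz$ is Lebesgue measure on $\mathbb{R}^d$. A measurable $q:\mathbb{R}\times\mathbb{R}^d\to\mathbb{R}$ belongs to the parabolic Kato class for $p$ if $$\lim_{h\to0+}\ \sup_{s\in\mathbb{R},\,x\in\mathbb{R}^d}\int_{\mathbb{R}^d}\int_s^{s+h}p(s,x,u,z)|q(u,z)|\,du\,dz=0$$ and $$\lim_{h\to0+}\ \sup_{t\in\mathbb{R},\,y\in\mathbb{R}^d}\int_{\mathbb{R}^d}\int_{t-h}^{t}p(u,z,t,y)|q(u,z)|\,du\,dz=0 .$$ A measurable $q:\mathbb{R}\times\mathbb{R}^d\to\mathbb{R}$ is relatively Kato if $\eta^*(|q|)=0$,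 where for a nonnegative measurable $q$, $\eta^*(q)$ is the infimum ($+\infty$ if there are none) of all $\eta>0$ for which there exists $h>0$ such that for all $x,y\in\mathbb{R}^d$ and all $s<t\le s+h$, $$\int_s^t\int_{\mathbb{R}^d}p(s,x,u,z)q(u,z)p(u,z,t,y)\,dz\,du\le\eta\,p(s,x,t,y).$$ The relative Kato class is the class of relatively Kato functions. *)

(* Defs.v *)
From HB Require Import structures.
From mathcomp Require Import all_boot all_order all_algebra.
From mathcomp Require Import all_classical all_reals all_analysis.
From mathcomp Require Import complex.
From mathcomp Require Import measurable_realfun.

Set Implicit Arguments.
Unset Strict Implicit.
Unset Printing Implicit Defensive.
Import Order.TTheory GRing.Theory Num.Theory.
Import numFieldNormedType.Exports.
Local Open Scope classical_set_scope.
Local Open Scope ring_scope.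

Section borel_rV.
Context (R : realType) (n : nat).

(* R^n is 'rV[R]_n. Its sigma-algebra is generated by the open sets; by
   measurable_coord and measurable_fun_rV it is also the product one, so that
   the library's product sigma-algebra on R * 'rV[R]_n is again the Borel one. *)
HB.instance Definition _ := @isMeasurable.Build default_measure_display
  'rV[R]_n <<s @open 'rV[R]_n >> (@sigma_algebra0 _ _ _)
  (@sigma_algebraC _ _) (@sigma_algebra_bigcup _ _ _).

Lemma measurable_coord (i : 'I_n) :
  measurable_fun [set: 'rV[R]_n] (fun x => x ord0 i : R).
Proof.
apply: (measurability _ (RGenOInfty.measurableE R)) => _ [_ [a ->] <-].
rewrite setTI; apply: sub_sigma_algebra.
by apply: open_comp => [x _|]; [exact: coord_continuous|exact: interval_open].
Qed.

Lemma measurable_fun_rV d (T : measurableType d) (f : T -> 'rV[R]_n) :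
  (forall i, measurable_fun [set: T] (fun t => f t ord0 i : R)) ->
  measurable_fun [set: T] f.
Proof.
move=> mf; apply: (@measurability _ _ _ _ _ _ (@open 'rV[R]_n)) => //.
move=> _ [U oU <-]; rewrite setTI.
pose B (qk : 'rV[rat]_n * nat) : set 'rV[R]_n :=
  ball (map_mx ratr qk.1 : 'rV[R]_n) qk.2.+1%:R^-1.
pose B' qk := if `[< B qk `<=` U >] then B qk else set0.
have mB qk : measurable (f @^-1` B qk).
  have -> : f @^-1` B qk = \big[setI/setT]_(i < n)
      ((fun t => f t ord0 i) @^-1` ball (ratr (qk.1 ord0 i) : R) qk.2.+1%:R^-1).
    apply/seteqP; split => t; rewrite -bigcap_seq.
      by move=> [_ Bt] i _; have := Bt ord0 i; rewrite mxE.
    move=> Bt; split=> [|j i]; first by rewrite invr_gt0.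
    by rewrite (ord1 j) mxE; apply: Bt; rewrite /= mem_index_enum.
  apply: bigsetI_measurable => i _; rewrite -[X in measurable X]setTI.
  by apply: mf => //; rewrite ball_itv; exact: measurable_itv.
have -> : U = \bigcup_qk B' qk.
  apply/seteqP; split => [x Ux|x [qk _]]; last first.
    by rewrite /B'; case: asboolP => // BU /BU.
  have /nbhs_ballP[e /= e0 eU] : nbhs x U by exact: open_nbhs_nbhs.
  have e20 : 0 < e / 2 by rewrite divr_gt0.
  have [k _ /(_ _ (leqnn k))/= ke] := near_infty_natSinv_lt (PosNum e20).
  have rk0 : 0 < k.+1%:R^-1 :> R by rewrite invr_gt0.
  have /choice[q qx] i : exists q, ratr q \in `](x ord0 i - k.+1%:R^-1),
      (x ord0 i + k.+1%:R^-1)[.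
    by apply: rat_in_itvoo; rewrite ltrD2l gtrN.
  have xB : ball x k.+1%:R^-1 (map_mx ratr (\row_i q i) : 'rV[R]_n).
    split=> // j i; rewrite (ord1 j) !mxE.
    have := qx i; rewrite in_itv/= => /andP[lq qr].
    by rewrite /ball/= distrC ltr_norml ltrBrDl lq/= ltrBlDl.
  exists (\row_i q i, k) => //; rewrite /B'; case: asboolP => [_|[]] /=.
    exact: ball_sym.
  move=> y By; apply: eU; apply: le_ball (ball_triangle xB By).
  by rewrite (splitr e) ltW// ltrD.
rewrite preimage_bigcup; apply: countable_bigcupT_measurable => // qk.
by rewrite /B'; case: asboolP => // _; rewrite preimage_set0.
Qed.

Lemma measurable_box (A : 'I_n -> set R) : (forall i, measurable (A i)) ->
  measurable [set x : 'rV[R]_n | forall i, A i (x ord0 i)].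
Proof.
move=> mA; have -> : [set x : 'rV[R]_n | forall i, A i (x ord0 i)] =
    \big[setI/setT]_(i < n) ((fun x : 'rV[R]_n => x ord0 i) @^-1` A i).
  apply/seteqP; split => x; rewrite -bigcap_seq => xA i.
    by move=> _; exact: xA.
  by apply: xA; rewrite /= mem_index_enum.
apply: bigsetI_measurable => i _; rewrite -[X in measurable X]setTI.
exact: measurable_coord.
Qed.

End borel_rV.

Section lebesgue_rV.
Context (R : realType).

Definition cons_rV n (xv : R * 'rV[R]_n) : 'rV[R]_n.+1 :=
  \row_i oapp (xv.2 ord0) xv.1 (unlift ord0 i).

Lemma measurable_cons_rV n :
  measurable_fun [set: measurableTypeR R * 'rV[R]_n] (@cons_rV n).
Proof.
apply: measurable_fun_rV => i.
have [j ->|->] := unliftP ord0 i.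
  apply: (eq_measurable_fun (fun xv : measurableTypeR R * 'rV[R]_n =>
    xv.2 ord0 j)) => [xv _|]; first by rewrite mxE liftK.
  exact: measurableT_comp (measurable_coord j) measurable_snd.
apply: (eq_measurable_fun (fst : measurableTypeR R * 'rV[R]_n -> R)) => [xv _|].
  by rewrite mxE unlift_none.
exact: measurable_fst.
Qed.

Lemma cons_rV_head_tail n (v : 'rV[R]_n.+1) :
  cons_rV (v ord0 ord0, \row_j v ord0 (lift ord0 j)) = v.
Proof.
by apply/rowP => i; rewrite mxE; case: unliftP => [j ->|->] /=; rewrite ?mxE.
Qed.

Section lebesgue_step.
Local Open Scope ereal_scope.
Context n (mu : {sigma_finite_measure set 'rV[R]_n -> \bar R}).

Definition lebesgue_step : set 'rV[R]_n.+1 -> \bar R :=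
  pushforward (@lebesgue_measure R \x mu) (@cons_rV n).

Let measurable_preimage (A : set 'rV[R]_n.+1) : measurable A ->
  measurable (@cons_rV n @^-1` A : set (measurableTypeR R * 'rV[R]_n)).
Proof.
by move=> mA; rewrite -[X in measurable X]setTI; exact: measurable_cons_rV.
Qed.

Let lebesgue_step0 : lebesgue_step set0 = 0.
Proof. by rewrite /lebesgue_step /pushforward preimage_set0 measure0. Qed.

Let lebesgue_step_ge0 A : 0 <= lebesgue_step A.
Proof. by rewrite /lebesgue_step /pushforward; exact: measure_ge0. Qed.

Let lebesgue_step_sigma_additive : semi_sigma_additive lebesgue_step.
Proof.
move=> F mF tF mUF; rewrite /lebesgue_step /pushforward preimage_bigcup.
apply: measure_semi_sigma_additive => [k||].
- exact: measurable_preimage.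
- apply/trivIsetP => /= i j _ _ ij; rewrite -preimage_setI.
  by move/trivIsetP : tF => /(_ _ _ _ _ ij) ->//; rewrite preimage_set0.
- by rewrite -preimage_bigcup; exact: measurable_preimage.
Qed.

HB.instance Definition _ := isMeasure.Build _ _ _ lebesgue_step
  lebesgue_step0 lebesgue_step_ge0 lebesgue_step_sigma_additive.

Let lebesgue_step_sigma_finite : sigma_finite [set: 'rV[R]_n.+1] lebesgue_step.
Proof.
have /sigma_finiteP[F [TF ndF Foo]] := sigma_finiteT (@lebesgue_measure R).
have /sigma_finiteP[G [TG ndG Goo]] := sigma_finiteT mu.
pose ht (v : 'rV[R]_n.+1) : measurableTypeR R * 'rV[R]_n :=
  (v ord0 ord0, \row_j v ord0 (lift ord0 j)).
have mht : measurable_fun setT ht.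
  apply: measurable_fun_pair; first exact: measurable_coord.
  apply: measurable_fun_rV => j; apply: (eq_measurable_fun
    (fun v : 'rV[R]_n.+1 => v ord0 (lift ord0 j))) => [v _|]; last first.
    exact: measurable_coord.
  by rewrite mxE.
exists (fun k => ht @^-1` (F k `*` G k)) => [|k].
  apply/seteqP; split => // v _.
  have : [set: measurableTypeR R] (ht v).1 by [].
  have : [set: 'rV[R]_n] (ht v).2 by [].
  rewrite TF TG => -[l _ Gl] [k _ Fk]; exists (maxn k l) => //; split => /=.
  - by move: Fk; exact/subsetPset/ndF/leq_maxl.
  - by move: Gl; exact/subsetPset/ndG/leq_maxr.
have [mF Fk] := Foo k; have [mG Gk] := Goo k; split.
  by rewrite -[X in measurable X]setTI; apply: mht => //; exact: measurableX.
rewrite /lebesgue_step /pushforward -comp_preimage.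
rewrite (_ : ht \o @cons_rV n = id) ?preimage_id.
  rewrite product_measure1E//.
  by rewrite lte_mul_pinfty// ge0_fin_numE.
apply/funext => -[x v].
rewrite /ht/= mxE unlift_none/=; congr pair.
by apply/rowP => j; rewrite !mxE liftK.
Qed.

HB.instance Definition _ := Measure_isSigmaFinite.Build _ _ _ lebesgue_step
  lebesgue_step_sigma_finite.

End lebesgue_step.

(* n-dimensional Lebesgue measure, as the n-fold product; see lebesgue_rV_box. *)
Fixpoint lebesgue_rV n : {sigma_finite_measure set 'rV[R]_n -> \bar R} :=
  if n is m.+1 then lebesgue_step (lebesgue_rV m) else \d_(0 : 'rV[R]_0).

Lemma lebesgue_rV_box n (A : 'I_n -> set R) : (forall i, measurable (A i)) ->
  lebesgue_rV n [set x | forall i, A i (x ord0 i)] =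
  (\prod_(i < n) lebesgue_measure (A i))%E.
Proof.
elim: n A => [A _|n IHn A mA].
  rewrite big_ord0 /= diracE mem_set// => i; by have := ltn_ord i.
rewrite big_ord_recl -IHn//= /lebesgue_step /pushforward.
have mB := measurable_box (fun i => mA (lift ord0 i)).
rewrite -product_measure1E//; last exact: mA.
congr (product_measure1 _ _ _); apply/seteqP; split => -[x v] /=.
  move=> xvA; split => [|i].
    by have := xvA ord0; rewrite mxE unlift_none.
  by have := xvA (lift ord0 i); rewrite mxE liftK.
move=> [xA vA] i; rewrite mxE.
by case: unliftP => [j ->|->].
Qed.

End lebesgue_rV.

Section stable_density.
Context (R : realType) (d : nat).
Implicit Types (x y z xi : 'rV[R]_d) (f g : 'rV[R]_d -> R).

Definition dotv x y : R := \sum_(i < d) x ord0 i * y ord0 i.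

(* Euclidean norm: `|x| on 'rV[R]_d is the sup norm. *)
Definition enorm x : R := Num.sqrt (dotv x x).

Definition partials (s : seq 'I_d) f : 'rV[R]_d -> R :=
  foldr (fun i g => 'D_(delta_mx ord0 i) g) f s.

(* C^oo: partial derivatives of all orders exist everywhere and are continuous. *)
Definition smooth f := forall s : seq 'I_d,
  continuous (partials s f) /\
  forall i x, derivable (partials s f) x (delta_mx ord0 i).

(* The integral of f z * e^(i z.xi), as a pair of real integrals; it is meaningful
   for integrable f. *)
Definition fourier f xi : R[i] :=
  ((\int[lebesgue_rV R d]_z (f z * cos (dotv z xi))) +i*
   (\int[lebesgue_rV R d]_z (f z * sin (dotv z xi))))%C.

(* This determines p t for every t > 0 (Fourier inversion and continuity);
   the values p t with t <= 0 are irrelevant. *)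
Definition is_stable_density (alpha : R) (p : R -> 'rV[R]_d -> R) :=
  forall t : R, 0 < t ->
    [/\ smooth (p t),
        (lebesgue_rV R d).-integrable [set: 'rV[R]_d] (EFin \o p t) &
        forall xi, fourier (p t) xi = (expR (- t * enorm xi `^ alpha))%:C%C].

Definition transition (p : R -> 'rV[R]_d -> R) (s : R) x (t : R) y : R :=
  if s < t then p (t - s) (y - x) else 0.

End stable_density.

Section Kato_classes.
Context (R : realType) (d : nat).
Variable k : R -> 'rV[R]_d -> R -> 'rV[R]_d -> R.
Implicit Types q : R * 'rV[R]_d -> R.
Local Notation leb1 := (@lebesgue_measure R).
Local Notation lebd := (lebesgue_rV R d).

Definition parabolic_Kato_class : set (R * 'rV[R]_d -> R) :=
  [set q : R * 'rV[R]_d -> R | [/\ measurable_fun [set: R * 'rV[R]_d] q,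
    ereal_sup [set (\int[lebd]_z \int[leb1]_(u in `[sx.1, (sx.1 + h)%R])
        (k sx.1 sx.2 u z * `|q (u, z)|)%:E)%E | sx in [set: R * 'rV[R]_d]]
      @[h --> 0^'+] --> 0%E &
    ereal_sup [set (\int[lebd]_z \int[leb1]_(u in `[(ty.1 - h)%R, ty.1])
        (k u z ty.1 ty.2 * `|q (u, z)|)%:E)%E | ty in [set: R * 'rV[R]_d]]
      @[h --> 0^'+] --> 0%E]].

(* The infimum of the empty set in \bar R is +oo. *)
Definition eta_star q : \bar R :=
  ereal_inf [set eta%:E | eta in [set eta : R | 0 < eta /\
    exists2 h : R, 0 < h & forall (x y : 'rV[R]_d) (s t : R), s < t <= s + h ->
      (\int[leb1]_(u in `[s, t]) \int[lebd]_z
         (k s x u z * q (u, z) * k u z t y)%:E <= (eta * k s x t y)%:E)%E]].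

Definition relative_Kato_class : set (R * 'rV[R]_d -> R) :=
  [set q : R * 'rV[R]_d -> R | measurable_fun [set: R * 'rV[R]_d] q /\
           eta_star (fun uz => `|q uz|) = 0%E].

End Kato_classes.

(* Main.v *)
(* Write b = alpha/2. Since 1 - (1 - w)^b has a power series with nonnegative
   coefficients, taking w = exp(- l / n) and letting n go to infinity shows that
   exp(- t l^b) is a completely monotone function of l. Hence a linear
   inequality, valid for all v >= 0, between exponentials exp(- l v) and heat
   kernels G_v(x), remains valid once exp(- l v) is replaced by exp(- t l^b) and
   G_v(x) by the stable density p_t(x), by Fourier inversion. For N >= |x|^2, the
   heat kernel is bounded above (when N = |x|^2) by
   C N^(-d/2) (1 - exp(- v/N)) and below by
   c N^(-d/2) (- exp(- v/N) + exp(- 2 v/N) / 2 + exp(- dl v/N) / 2), which gives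
   p_t(x) ~ min(t^(-d/alpha), t/|x|^(d+alpha)) and then the 3P inequality
     p(s,x,u,z) p(u,z,t,y) <= C p(s,x,t,y) (p(s,x,u,z) + p(u,z,t,y)).
   By the 3P inequality a parabolic Kato function is relatively Kato. Conversely,
   integrating the relative Kato inequality in y (or in x) gives the parabolic
   Kato condition, because p(u,z,t,.) and p(s,.,u,z) integrate to 1. *)

Require Import Defs.
From HB Require Import structures.
From mathcomp Require Import all_boot all_order all_algebra.
From mathcomp Require Import all_classical all_reals all_analysis.
From mathcomp Require Import measurable_realfun ring lra.
Import Order.TTheory GRing.Theory Num.Theory.
Import numFieldNormedType.Exports.
Set Implicit Arguments.
Unset Strict Implicit.
Unset Printing Implicit Defensive.
Local Open Scope classical_set_scope.
Local Open Scope ring_scope.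

(** * Lebesgue integration on R^d *)

(** The density is given only by smoothness, integrability and its Fourier transform; its sign, its
    pointwise decay and its joint measurability in time and space all have to be derived. No
    subordinator is constructed: complete monotonicity is encoded as positivity under every
    admissible functional, and since such a functional may contain an integral over xi, it can carry
    a Fourier integral, so that an inequality for heat kernels is transferred in one step. The
    weight of that integral must be integrable, whence a Gaussian factor exp(- e |xi|^2). The same
    factor reduces Fourier inversion to Fubini, and it is removed by letting e tend to 0, where the
    continuity of the density is used. The lower bound near the diagonal needs no argument of its
    own: N may exceed |x|^2, and N of the order of max(|x|^2, t^(1/b)) covers every x. The upper
    bound there comes from scaling at x = 0. In the passage back from the relative condition, the
    kernel has mass 1 only for strictly ordered times, so the time interval is opened at the end
    whose space variable is integrated out. *)

Section rV_measurability.
Context (R : realType).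

Lemma measurable_dotv n d (T : measurableType d) (f g : T -> 'rV[R]_n) :
  measurable_fun setT f -> measurable_fun setT g ->
  measurable_fun setT (fun t => dotv (f t) (g t)).
Proof.
move=> mf mg; apply: measurable_sum => i; apply: measurable_funM.
  exact: measurableT_comp (measurable_coord i) mf.
exact: measurableT_comp (measurable_coord i) mg.
Qed.

Lemma measurable_affine_rV n d (T : measurableType d) (c : T -> R)
    (f g : T -> 'rV[R]_n) : measurable_fun setT c ->
  measurable_fun setT f -> measurable_fun setT g ->
  measurable_fun setT (fun t => c t *: f t + g t).
Proof.
move=> mc mf mg; apply: measurable_fun_rV => i.
apply: (eq_measurable_fun (fun t => c t * f t ord0 i + g t ord0 i)).
  by move=> t _; rewrite !mxE.
apply: measurable_funD.
  apply: measurable_funM => //.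
  exact: measurableT_comp (measurable_coord i) mf.
exact: measurableT_comp (measurable_coord i) mg.
Qed.

Lemma measurable_sub_rV n d (T : measurableType d) (f g : T -> 'rV[R]_n) :
  measurable_fun setT f -> measurable_fun setT g ->
  measurable_fun setT (fun t => f t - g t).
Proof.
move=> mf mg; apply: (eq_measurable_fun (fun t => -1 *: g t + f t)).
  by move=> t _; rewrite scaleN1r addrC.
exact: measurable_affine_rV.
Qed.

End rV_measurability.

Section rV_integration.
Context (R : realType).
Local Open Scope ereal_scope.
Local Notation leb := (@lebesgue_measure R).

Lemma ge0_integral_rVS n (f : 'rV[R]_n.+1 -> \bar R) :
  measurable_fun setT f -> (forall x, 0 <= f x) ->
  \int[lebesgue_rV R n.+1]_x f x =
  \int[leb]_a \int[lebesgue_rV R n]_v f (cons_rV (a, v)).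
Proof.
move=> mf f0.
rewrite [LHS](@ge0_integral_pushforward _ _ (measurableTypeR R * 'rV[R]_n)%type
  'rV[R]_n.+1 R _ (@measurable_cons_rV R n) (leb \x lebesgue_rV R n) setT f)//.
rewrite preimage_setT fubini_tonelli1//.
  exact: measurableT_comp mf (@measurable_cons_rV R n).
by move=> x; exact: f0.
Qed.

Lemma integral_rVS n (f : 'rV[R]_n.+1 -> \bar R) :
  (lebesgue_rV R n.+1).-integrable setT f ->
  \int[lebesgue_rV R n.+1]_x f x =
  \int[leb]_a \int[lebesgue_rV R n]_v f (cons_rV (a, v)).
Proof.
move=> intf.
have mf := measurable_int _ intf.
have mc := @measurable_cons_rV R n.
have intc : (leb \x lebesgue_rV R n).-integrable setT (f \o @cons_rV R n).
  apply/integrableP; split; first exact: measurableT_comp mf mc.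
  move/integrableP : intf => [_].
  rewrite [X in X < _ -> _](@ge0_integral_pushforward _ _
    (measurableTypeR R * 'rV[R]_n)%type 'rV[R]_n.+1 R _ mc
    (leb \x lebesgue_rV R n) setT)//.
  exact: measurableT_comp.
rewrite [LHS](@integral_pushforward _ _ (measurableTypeR R * 'rV[R]_n)%type
  'rV[R]_n.+1 R _ mc (leb \x lebesgue_rV R n) setT f)//.
by rewrite preimage_setT -integral12_prod_meas1.
Qed.

Lemma integral_rV0 (f : 'rV[R]_0 -> \bar R) :
  measurable_fun setT f -> \int[lebesgue_rV R 0]_x f x = f 0%R.
Proof.
by move=> mf; rewrite /= integral_dirac// diracE mem_set// mul1e.
Qed.

End rV_integration.

Section affine_change_of_variables.
Context (R : realType).
Local Open Scope ereal_scope.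
Local Notation leb := (@lebesgue_measure R).

(** Uniqueness of Lebesgue measure: c times its image under the affine map gives every interval ]x,
    y] its length. *)
Lemma ge0_integral_affine (c b : R) (f : R -> \bar R) : (0 < c)%R ->
  measurable_fun setT f -> (forall a, 0 <= f a) ->
  \int[leb]_a f (c * a + b)%R = (c^-1)%:E * \int[leb]_a f a.
Proof.
move=> c0 mf f0.
have mphi : measurable_fun [set: measurableTypeR R]
    ((fun a => c * a + b)%R : _ -> measurableTypeR R).
  by apply: measurable_funD => //; exact: measurable_funM.
pose phi : {mfun measurableTypeR R >-> measurableTypeR R} :=
  HB.pack ((fun a => c * a + b)%R : _ -> measurableTypeR R)
    (isMeasurableFun.Build _ _ _ _ _ mphi).
have cge0 : (0 <= c)%R by exact: ltW.
pose k : {nonneg R} := NngNum cge0.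
have leb_phi A : measurable A -> leb A = mscale k (pushforward leb phi) A.
  apply: lebesgue_measure_unique => _ [[x y] _ <-].
  have phiE : phi @^-1` [set` `]x, y]%R] = [set` `](x - b) / c, (y - b) / c]%R].
    apply/seteqP; split => a /=; rewrite !in_itv/= => /andP[xa ay];
      apply/andP; split.
    - by rewrite ltr_pdivrMr// ltrBlDr mulrC.
    - by rewrite ler_pdivlMr// lerBrDr mulrC.
    - by move: xa; rewrite ltr_pdivrMr// ltrBlDr mulrC.
    - by move: ay; rewrite ler_pdivlMr// lerBrDr mulrC.
  transitivity (c%:E * leb [set` `](x - b) / c, (y - b) / c]%R]); last by rewrite -phiE.
  rewrite !lebesgue_measure_itv/= !lte_fin ltr_pM2r ?invr_gt0// ltrD2r.
  case: ifP => _; last by rewrite mule0.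
  by rewrite -!EFinB -EFinM -mulrBl mulrCA divff ?gt_eqF// mulr1 opprB addrA subrK.
transitivity (\int[pushforward leb phi]_a f a).
  rewrite [RHS](@ge0_integral_pushforward _ _ (measurableTypeR R)
    (measurableTypeR R) R phi mphi leb setT f)//.
have -> : \int[leb]_a f a = c%:E * \int[pushforward leb phi]_a f a.
  rewrite -(@ge0_integral_mscale _ _ R (pushforward leb phi) setT measurableT k f)//.
  by apply: eq_measure_integral => /= A mA _; exact: (leb_phi mphi).
by rewrite muleA -EFinM mulVf ?gt_eqF// mul1e.
Qed.

Lemma ge0_integral_affine_rV n (c : R) (b : 'rV[R]_n) (f : 'rV[R]_n -> \bar R) :
  (0 < c)%R -> measurable_fun setT f -> (forall x, 0 <= f x) ->
  \int[lebesgue_rV R n]_x f (c *: x + b)%R =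
  (c ^- n)%:E * \int[lebesgue_rV R n]_x f x.
Proof.
move=> c0; elim: n b f => [|n IH] b f mf f0.
  rewrite !integral_rV0//.
    by rewrite expr0 invr1 mul1e; congr f; apply/rowP => -[].
  by apply: measurableT_comp mf _; exact: measurable_affine_rV.
have mcons : measurable_fun setT (@cons_rV R n) by exact: measurable_cons_rV.
rewrite [in RHS]ge0_integral_rVS// ge0_integral_rVS//; last first.
  by apply: measurableT_comp mf _; exact: measurable_affine_rV.
pose b' : 'rV[R]_n := \row_j b ord0 (lift ord0 j).
have consE a (v : 'rV[R]_n) : (c *: cons_rV (a, v) + b)%R =
    cons_rV (c * a + b ord0 ord0, c *: v + b')%R.
  apply/rowP => i; rewrite !mxE; case: unliftP => [j ->|->] //=.
  by rewrite !mxE.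
pose g a := \int[lebesgue_rV R n]_v f (cons_rV (a, v)).
have mg : measurable_fun setT g.
  apply: (measurable_fun_fubini_tonelli_F (f \o @cons_rV R n)) => [|x].
    exact: measurableT_comp mf _.
  exact: f0.
have g0 a : 0 <= g a by apply: integral_ge0 => v _; exact: f0.
transitivity (\int[leb]_a ((c ^- n)%:E * g (c * a + b ord0 ord0)%R)).
  apply: eq_integral => a _.
  under eq_integral do rewrite consE.
  rewrite (IH b' (fun v => f (cons_rV (c * a + b ord0 ord0, v)%R)))//.
  exact: measurableT_comp (measurableT_comp mf mcons) (measurable_pair1 _).
rewrite ge0_integralZl//; first last.
- by rewrite lee_fin invr_ge0 exprn_ge0// ltW.
- apply: measurableT_comp mg _.
  by apply: measurable_funD => //; exact: measurable_funM.
rewrite ge0_integral_affine// muleA -EFinM; congr (_%:E * _).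
by rewrite exprS invfM mulrC.
Qed.

End affine_change_of_variables.

(** * Gaussian integrals *)

Section dominated_convergence.
Context d (T : measurableType d) (R : realType).
Variables (mu : {measure set T -> \bar R}) (f_ : nat -> T -> R) (f g : T -> R).
Hypothesis mf_ : forall n, measurable_fun setT (f_ n).
Hypothesis f_f : forall x, f_ n x @[n --> \oo] --> f x.
Hypothesis intg : mu.-integrable setT (EFin \o g).
Hypothesis f_g : forall n x, `|f_ n x| <= g x.

Let mf : measurable_fun setT (EFin \o f).
Proof.
apply/measurable_EFinP; apply: (measurable_fun_cvg (h := f_)) => //.
Qed.

Let dct : mu.-integrable setT (EFin \o f) /\
  (\int[mu]_x (f_ n x)%:E @[n --> \oo] --> \int[mu]_x (f x)%:E)%E.
Proof.
have mf_E n : measurable_fun setT (EFin \o f_ n) by exact/measurable_EFinP.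
have f_fE : {ae mu, forall x, [set: T] x -> (EFin \o f_ n) x @[n --> \oo] --> (EFin \o f) x}.
  by apply: aeW => x _; apply: cvg_EFin; [exact: nearW|exact: f_f].
have f_gE : {ae mu, forall x n, [set: T] x -> (`|(EFin \o f_ n) x| <= (EFin \o g) x)%E}.
  by apply: aeW => x n _; exact: f_g.
by have [] := dominated_convergence measurableT mf_E mf f_fE intg f_gE.
Qed.

Lemma dominated_cvg_integrable : mu.-integrable setT (EFin \o f).
Proof. by have [] := dct. Qed.

Lemma dominated_cvg_integral :
  (\int[mu]_x (f_ n x)%:E @[n --> \oo] --> \int[mu]_x (f x)%:E)%E.
Proof. by have [] := dct. Qed.

Lemma dominated_cvg_Rintegral :
  \int[mu]_x f_ n x @[n --> \oo] --> \int[mu]_x f x.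
Proof.
apply: fine_cvg; rewrite /Rintegral fineK.
  exact: dominated_cvg_integral.
exact: integrable_fin_num dominated_cvg_integrable.
Qed.

End dominated_convergence.

Section real_line.
Context (R : realType).
Local Notation leb := (@lebesgue_measure R).

Lemma integral_derive_eq0 (f f' : R -> R) :
  (forall a : R, is_derive a (1 : R) f (f' a)) -> continuous f' ->
  leb.-integrable setT (EFin \o f') ->
  f n%:R @[n --> \oo] --> (0 : R) -> f (- n%:R) @[n --> \oo] --> (0 : R) ->
  (\int[leb]_a (f' a)%:E = 0)%E.
Proof.
move=> df cf' intf' fy fNy.
pose D n := [set` `[(- n%:R), n%:R : R]].
have mD n : measurable (D n) by exact: measurable_itv.
have mf' : measurable_fun setT f' by exact: continuous_measurable_fun.
pose g n : R -> R := f' \_ (D n).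
have mg n : measurable_fun setT (g n).
  by apply/(measurable_restrictT _ (mD n)); exact: measurable_funTS.
have cg x : g ^~ x @ \oo --> f' x.
  apply: cvg_near_cst; exists (Num.bound `|x|) => // n /= xn.
  rewrite /g patchE mem_set// /D/= in_itv/= -ler_norml.
  by apply: (le_trans (ltW (archi_boundP _))) => //; rewrite ler_nat.
have gb n x : `|g n x| <= `|f' x|.
  by rewrite /g patchE; case: ifP => //= _; rewrite normr0.
have cvgI := @dominated_cvg_integral _ _ _ leb g f' (fun a => `|f' a|) mg cg
  (integrable_abse intf') gb.
have gE n : (\int[leb]_x (g n x)%:E = \int[leb]_(x in D n) (f' x)%:E)%E.
  by rewrite [RHS]integral_mkcond; apply: eq_integral => x _;
    rewrite /g !patchE; case: ifP.
have IE : (fun n => (\int[leb]_x (g n x)%:E)%E) =1 fun n => ((f n%:R)%:E - (f (- n%:R))%:E)%E.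
  (* The fundamental theorem of calculus needs - n < n, so n = 0 is separate: there both sides are
     0. *)
  move=> n; rewrite gE; case: n => [|n].
    rewrite oppr0 -EFinB subrr.
    rewrite /D oppr0 set_itv1 integral_set1//.
  apply: continuous_FTC2.
  - by rewrite -subr_gt0 opprK addr_gt0.
  - exact: continuous_subspaceT.
  - have cf : continuous f.
      move=> x; apply/differentiable_continuous/derivable1_diffP.
      by have [] := df x.
    split => [x _||]; first by have [] := df x.
      by apply: cvg_at_right_filter; exact: cf.
    by apply: cvg_at_left_filter; exact: cf.
  - by move=> x _; rewrite derive1E; have [_ ->] := df x.
have : ((f n%:R)%:E - (f (- n%:R))%:E)%E @[n --> \oo] --> 0%E.
  rewrite -(subee (erefl : (0 : \bar R) \is a fin_num)).
  by apply: cvgeB => //; apply: cvg_EFin => //; exact: nearW.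
rewrite -(funext IE) => cvg0.
exact: cvg_unique cvgI cvg0.
Qed.

Lemma integral_gauss (v : R) : 0 < v ->
  (\int[leb]_a (expR (- v * a ^+ 2))%:E = (Num.sqrt (pi / v))%:E)%E.
Proof.
move=> v0.
(* exp(- v a^2) is a multiple of the centred normal density of variance 1 / (2 v), whose mass is
   1. *)
pose s := Num.sqrt ((2 * v)^-1).
have s2 : s ^+ 2 = (2 * v)^-1 by rewrite sqr_sqrtr// invr_ge0 mulr_ge0// ltW.
have s0 : s != 0 by rewrite sqrtr_eq0 -ltNge invr_gt0 mulr_gt0.
have pdfE a : normal_pdf 0 s a =
    (Num.sqrt (pi / v))^-1 * expR (- v * a ^+ 2).
  rewrite normal_pdfE// /normal_peak /normal_fun subr0; congr (_ * _).
    by congr (Num.sqrt _)^-1; rewrite s2 -mulr_natr; field; rewrite gt_eqF.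
  by congr expR; rewrite s2 -mulr_natr; field; rewrite gt_eqF.
have c0 : 0 < Num.sqrt (pi / v) by rewrite sqrtr_gt0 divr_gt0// pi_gt0.
have := integral_normal_pdf 0 s.
under eq_integral do rewrite pdfE EFinM.
rewrite ge0_integralZl//.
- move=> /(congr1 (fun z => (Num.sqrt (pi / v))%:E * z)%E).
  by rewrite mule1 muleA -EFinM divff ?gt_eqF// mul1e.
- apply/measurable_EFinP; apply: measurableT_comp => //.
  exact: measurable_funM.
Qed.

Lemma integrable_gauss (v : R) : 0 < v ->
  leb.-integrable setT (EFin \o (fun a => expR (- v * a ^+ 2))).
Proof.
move=> v0; apply/integrableP; split.
  apply/measurable_EFinP; apply: measurableT_comp => //.
  exact: measurable_funM.
under eq_integral do rewrite /= ger0_norm ?expR_ge0//.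
by rewrite integral_gauss// ltry.
Qed.

(** Half of the exponent absorbs |a| <= 1 + a^2. The result is the integrable majorant for
    differentiating a Gaussian integral under the integral sign. *)
Lemma norm_mul_gauss_le (v a : R) : 0 < v ->
  `|a| * expR (- v * a ^+ 2) <= (1 + 2 / v) * expR (- (v / 2) * a ^+ 2).
Proof.
move=> v0.
have -> : - v * a ^+ 2 = - (v / 2) * a ^+ 2 - (v / 2) * a ^+ 2 by field.
rewrite expRD [X in X <= _]mulrA [X in X <= _]mulrAC ler_pM2r ?expR_gt0//.
rewrite expRN ler_pdivrMr ?expR_gt0//.
have h1 := expR_ge1Dx (v / 2 * a ^+ 2).
have v2 : 0 < 2 / v by rewrite divr_gt0.
have a1 : `|a| <= 1 + a ^+ 2.
  rewrite -real_normK ?num_real//.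
  have := normr_ge0 a; set b := `|a| => b0; nra.
have h2 : a ^+ 2 <= 2 / v * expR (v / 2 * a ^+ 2).
  apply: (@le_trans _ _ (2 / v * (v / 2 * a ^+ 2))).
    by rewrite mulrA (_ : 2 / v * (v / 2) = 1) ?mul1r//; field; rewrite gt_eqF.
  by rewrite ler_pM2l//; lra.
have h3 : 1 <= expR (v / 2 * a ^+ 2).
  apply: le_trans h1; rewrite lerDl mulr_ge0 ?sqr_ge0//; lra.
by rewrite mulrDl mul1r; lra.
Qed.

Lemma cvg_gauss0 (v : R) : 0 < v ->
  expR (- v * n%:R ^+ 2) @[n --> \oo] --> (0 : R).
Proof.
move=> v0.
apply: (@squeeze_cvgr _ _ _ _ (cst 0) (fun n => 2 / v * harmonic n)) => //.
- near=> n; rewrite expR_ge0/= mulNr expRN.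
  have n1 : 1 <= n%:R :> R by rewrite ler1n; near: n; exact: nbhs_infty_gt.
  have n0 : 0 < n.+1%:R :> R by [].
  rewrite /harmonic -[2 / v]invf_div -invfM lef_pV2 ?posrE ?expR_gt0 ?mulr_gt0//.
    apply: le_trans (expR_ge1Dx _); rewrite -[n.+1%:R]natr1.
    have : v * n%:R <= v * n%:R ^+ 2 by rewrite ler_pM2l// expr2 ler_peMl// (le_trans _ n1).
    have : v * 1 <= v * n%:R by rewrite ler_pM2l.
    lra.
- exact: cvg_cst.
- rewrite -(mulr0 (2 / v)); apply: cvgM; [exact: cvg_cst|exact: cvg_harmonic].
Unshelve. all: end_near. Qed.

End real_line.

Lemma integrable_dominated d (T : measurableType d) (R : realType)
    (mu : {measure set T -> \bar R}) (f g : T -> R) :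
  measurable_fun setT f -> mu.-integrable setT (EFin \o g) ->
  (forall x, `|f x| <= g x) -> mu.-integrable setT (EFin \o f).
Proof.
move=> mf ig fg; apply: (le_integrable measurableT _ _ ig).
  exact/measurable_EFinP.
by move=> x _ /=; rewrite lee_fin (le_trans (fg x))// ler_norm.
Qed.

Lemma integrableZl_EFin d (T : measurableType d) (R : realType)
    (mu : {measure set T -> \bar R}) (c : R) (f : T -> R) :
  mu.-integrable setT (EFin \o f) -> mu.-integrable setT (EFin \o (fun x => c * f x)).
Proof.
move=> intf; rewrite (_ : _ \o _ = fun x => (c%:E * (EFin \o f) x)%E)//.
exact: integrableZl.
Qed.

Lemma integrableD_EFin d (T : measurableType d) (R : realType)
    (mu : {measure set T -> \bar R}) (f g : T -> R) :
  mu.-integrable setT (EFin \o f) -> mu.-integrable setT (EFin \o g) ->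
  mu.-integrable setT (EFin \o (fun x => f x + g x)).
Proof.
move=> intf intg; rewrite (_ : _ \o _ = (EFin \o f) \+ (EFin \o g))%E//.
exact: integrableD.
Qed.

Section gauss_fourier.
Context (R : realType).
Local Notation leb := (@lebesgue_measure R).

Let gausscos (v th x a : R) : R := expR (- v * a ^+ 2) * cos (a * x + th).

Let continuous_gauss v : continuous (fun a : R => expR (- v * a ^+ 2)).
Proof.
move=> a; apply: continuous_comp; last exact: continuous_expR.
by apply: cvgM; [exact: cvg_cst|exact: exprn_continuous].
Qed.

Let continuous_affine x th : continuous (fun a : R => a * x + th).
Proof.
by move=> a; apply: cvgD; [apply: cvgM; [exact: cvg_id|exact: cvg_cst]|exact: cvg_cst].
Qed.

Let continuous_gausscos v th x : continuous (gausscos v th x).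
Proof.
move=> a; apply: cvgM; first exact: continuous_gauss.
by apply: continuous_comp; [exact: continuous_affine|exact: continuous_cos].
Qed.

Let continuous_gausssin v th x :
  continuous (fun a : R => - (a * (expR (- v * a ^+ 2) * sin (a * x + th)))).
Proof.
move=> a; apply: cvgN; apply: cvgM; first exact: cvg_id.
apply: cvgM; first exact: continuous_gauss.
by apply: continuous_comp; [exact: continuous_affine|exact: continuous_sin].
Qed.

Let is_derive_gausssin (v th y a : R) :
  is_derive a (1 : R) (fun a => expR (- v * a ^+ 2) * sin (a * y + th))
    (y * gausscos v th y a +
     2 * v * - (a * (expR (- v * a ^+ 2) * sin (a * y + th)))).
Proof.
by rewrite /gausscos; apply: is_derive_eq; rewrite /GRing.scale/=; ring.
Qed.

Let integrable_gausscos v th x : 0 < v ->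
  leb.-integrable setT (EFin \o gausscos v th x).
Proof.
move=> v0; apply: (@integrable_dominated _ _ _ leb _ _ _ (integrable_gauss v0)).
  by apply: continuous_measurable_fun; exact: continuous_gausscos.
by move=> a; rewrite normrM (ger0_norm (expR_ge0 _)) ler_piMr ?expR_ge0// cos_max.
Qed.

(** As a function of the frequency y, the integral K solves K' = - (y / (2 v)) K, so K y * exp(y^2 /
    (4 v)) is constant. The phase [th] serves the induction on the dimension, where the coordinates
    already fixed enter the cosine as a shift. *)
Lemma integral_gauss_cos (v th x : R) : 0 < v ->
  (\int[leb]_a (expR (- v * a ^+ 2) * cos (a * x + th))%:E =
   (Num.sqrt (pi / v) * expR (- x ^+ 2 / (4 * v)) * cos th)%:E)%E.
Proof.
move=> v0.
pose K y := \int[leb]_a gausscos v th y a.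
pose K' y := \int[leb]_a (- (a * (expR (- v * a ^+ 2) * sin (a * y + th)))).
have v20 : 0 < v / 2 by rewrite divr_gt0.
have intG : leb.-integrable setT
    (EFin \o (fun a => (1 + 2 / v) * expR (- (v / 2) * a ^+ 2))).
  exact: (@integrableZl_EFin _ _ _ leb _ _ (integrable_gauss v20)).
have dcos y a : is_derive y (1 : R) (fun y => gausscos v th y a)
    (- (a * (expR (- v * a ^+ 2) * sin (a * y + th)))).
  rewrite /gausscos; apply: is_derive_eq.
  by rewrite /GRing.scale/=; ring.
have p1 y a : partial1of2 (gausscos v th) y a =
    - (a * (expR (- v * a ^+ 2) * sin (a * y + th))).
  by rewrite partial1of2E; have [_ ->] := dcos y a.
have dK y : is_derive y (1 : R) K (K' y).
  have Iy : `]y - 1, y + 1[%classic y.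
    by rewrite /= in_itv/= ltrBlDr ltrDl ltr01.
  have h1 z : `]y - 1, y + 1[%classic z ->
      leb.-integrable setT (EFin \o gausscos v th z).
    by move=> _; exact: integrable_gausscos.
  have h2 z a : `]y - 1, y + 1[%classic z -> [set: R] a ->
      derivable (gausscos v th ^~ a) z 1.
    by move=> _ _; have [] := dcos z a.
  have h3 (a : R) : 0 <= (1 + 2 / v) * expR (- (v / 2) * a ^+ 2).
    by rewrite mulr_ge0 ?expR_ge0// addr_ge0// divr_ge0// ltW.
  have h4 z a : `]y - 1, y + 1[%classic z -> [set: R] a ->
      `|partial1of2 (gausscos v th) z a| <= (1 + 2 / v) * expR (- (v / 2) * a ^+ 2).
    move=> _ _; rewrite p1 normrN !normrM mulrA.
    apply: le_trans (norm_mul_gauss_le a v0).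
    by rewrite (ger0_norm (expR_ge0 _)) ler_piMr ?mulr_ge0 ?expR_ge0// sin_max.
  apply: DeriveDef.
    exact: (derivable_under_integral (mu := leb) measurableT Iy h1 h2 h3 intG h4).
  rewrite -derive1E.
  rewrite (differentiation_under_integral (mu := leb) measurableT Iy h1 h2 h3 intG h4).
  by apply: eq_Rintegral => a _; exact: p1.
have msin y : measurable_fun setT
    (fun a : R => - (a * (expR (- v * a ^+ 2) * sin (a * y + th)))).
  by apply: continuous_measurable_fun; exact: continuous_gausssin.
have isin y : leb.-integrable setT
    (EFin \o (fun a : R => - (a * (expR (- v * a ^+ 2) * sin (a * y + th))))).
  apply: (@integrable_dominated _ _ _ leb _ _ (msin y) intG) => a.
  rewrite normrN !normrM mulrA.
  apply: le_trans (norm_mul_gauss_le a v0).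
  by rewrite (ger0_norm (expR_ge0 _)) ler_piMr ?mulr_ge0 ?expR_ge0// sin_max.
(* Integration by parts: [g'] is the derivative of a function vanishing at both infinities, so its
   integral y K y + 2 v K' y is 0. *)
have K'E y : K' y = - (y / (2 * v)) * K y.
  pose g a := expR (- v * a ^+ 2) * sin (a * y + th).
  pose g' a := y * gausscos v th y a + 2 * v * - (a * (expR (- v * a ^+ 2) * sin (a * y + th))).
  have dg a : is_derive a (1 : R) g (g' a).
    exact: is_derive_gausssin.
  have cg' : continuous g'.
    move=> a; apply: cvgD; apply: cvgM; try exact: cvg_cst.
      exact: continuous_gausscos.
    exact: continuous_gausssin.
  have i1 := @integrableZl_EFin _ _ _ leb y _ (integrable_gausscos th y v0).
  have i2 := @integrableZl_EFin _ _ _ leb (2 * v) _ (isin y).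
  have ig' : leb.-integrable setT (EFin \o g') by exact: (@integrableD_EFin _ _ _ leb _ _ i1 i2).
  have g0 (u : R ^nat) : (forall n, u n ^+ 2 = n%:R ^+ 2) -> g (u n) @[n --> \oo] --> (0 : R).
    move=> un; apply: norm_cvg0.
    apply: (@squeeze_cvgr _ _ _ _ (cst 0) (fun n => expR (- v * n%:R ^+ 2))) => //.
    - apply: nearW => n; rewrite normr_ge0 /g un normrM (ger0_norm (expR_ge0 _)).
      by rewrite ler_piMr ?expR_ge0// sin_max.
    - exact: cvg_cst.
    - exact: cvg_gauss0.
  have := @integral_derive_eq0 _ g g' dg cg' ig' (g0 _ (fun=> erefl)) (g0 _ (fun n => sqrrN n%:R)).
  move=> /(congr1 fine); rewrite -[LHS]/(Rintegral leb setT g') /g' (RintegralD _ i1 i2)//=.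
  rewrite (RintegralZl _ _ (integrable_gausscos th y v0))// (RintegralZl _ _ (isin y))//.
  rewrite -/(K y) -/(K' y) => E.
  have v1 : v != 0 by rewrite gt_eqF.
  have -> : K' y = (2 * v * K' y) / (2 * v) by field.
  have -> : 2 * v * K' y = - (y * K y) by apply/eqP; rewrite -addr_eq0 addrC E.
  by field.
have KE : K x * expR (x ^+ 2 / (4 * v)) = K 0 * expR (0 ^+ 2 / (4 * v)).
  apply: (@is_derive_0_is_cst _ (fun x => K x * expR (x ^+ 2 / (4 * v)))) => y.
  have dKy := dK y; clearbody K K'; clear -dKy K'E v0.
  apply: is_derive_eq.
  rewrite K'E /GRing.scale/=; field; rewrite gt_eqF//.
have KE0 (y : R) : (\int[leb]_a (gausscos v th y a)%:E)%E = (K y)%:E.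
  by rewrite /K /Rintegral fineK//; exact: integrable_fin_num (integrable_gausscos _ _ v0).
have K0 : K 0 = Num.sqrt (pi / v) * cos th.
  apply: EFin_inj; rewrite -KE0 /gausscos.
  under eq_integral do rewrite mulr0 add0r EFinM.
  rewrite integralZr//; first by rewrite integral_gauss// -EFinM.
  exact: integrable_gauss.
rewrite KE0 mulrAC -K0; congr EFin.
move: KE; rewrite expr0n/= mul0r expR0 mulr1 => <-.
by rewrite -mulrA -expRD -mulrDl subrr mul0r expR0 mulr1.
Qed.

Lemma integrable_gauss_cos (v th x : R) : 0 < v ->
  leb.-integrable setT
    (EFin \o (fun a => expR (- v * a ^+ 2) * cos (a * x + th))).
Proof. exact: integrable_gausscos. Qed.

End gauss_fourier.

Section dotv_theory.
Context (R : realType).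

Lemma dotv_cons n (a b : R) (v w : 'rV[R]_n) :
  dotv (cons_rV (a, v)) (cons_rV (b, w)) = a * b + dotv v w.
Proof.
rewrite /dotv big_ord_recl !mxE !unlift_none; congr (_ + _).
by apply: eq_bigr => i _; rewrite !mxE liftK.
Qed.

Lemma dotvv_ge0 n (x : 'rV[R]_n) : 0 <= dotv x x.
Proof. by apply: sumr_ge0 => i _; rewrite -expr2 sqr_ge0. Qed.

Lemma dotvBr n (x y z : 'rV[R]_n) : dotv x (y - z) = dotv x y - dotv x z.
Proof.
by rewrite /dotv -sumrB; apply: eq_bigr => i _; rewrite !mxE mulrBr.
Qed.

Lemma dotvvN n (x : 'rV[R]_n) : dotv (- x) (- x) = dotv x x.
Proof. by apply: eq_bigr => i _; rewrite !mxE mulrNN. Qed.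

Lemma dotvC n (x y : 'rV[R]_n) : dotv x y = dotv y x.
Proof. by apply: eq_bigr => i _; rewrite mulrC. Qed.

Lemma dotv0 n (x : 'rV[R]_n) : dotv x 0 = 0.
Proof. by apply: big1 => i _; rewrite mxE mulr0. Qed.

Lemma dotvvZ n (c : R) (x : 'rV[R]_n) : dotv (c *: x) (c *: x) = c ^+ 2 * dotv x x.
Proof.
by rewrite /dotv mulr_sumr; apply: eq_bigr => i _; rewrite !mxE; ring.
Qed.

Lemma dotvvD_le n (x y : 'rV[R]_n) :
  dotv (x + y) (x + y) <= 2 * dotv x x + 2 * dotv y y.
Proof.
rewrite /dotv !mulr_sumr -big_split/=; apply: ler_sum => i _; rewrite !mxE.
by have := sqr_ge0 (x ord0 i - y ord0 i); nra.
Qed.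

End dotv_theory.

Section gauss_rV.
Context (R : realType).
Local Notation leb := (@lebesgue_measure R).

Let measurable_gauss_rV n (v : R) :
  measurable_fun setT (fun xi : 'rV[R]_n => expR (- v * dotv xi xi)).
Proof.
apply: measurableT_comp => //; apply: measurable_funM => //.
exact: measurable_dotv.
Qed.

Let emeasurable_gauss_rV n (v : R) :
  measurable_fun setT (fun xi : 'rV[R]_n => (expR (- v * dotv xi xi))%:E).
Proof. by apply/measurable_EFinP; exact: measurable_gauss_rV. Qed.

Lemma integral_gauss_rV n (v : R) : 0 < v ->
  (\int[lebesgue_rV R n]_xi (expR (- v * dotv xi xi))%:E =
   (Num.sqrt (pi / v) ^+ n)%:E)%E.
Proof.
move=> v0; elim: n => [|n IH].
  rewrite integral_rV0; first by rewrite dotv0 mulr0 expR0.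
  exact: emeasurable_gauss_rV.
rewrite ge0_integral_rVS//.
transitivity (\int[leb]_a ((expR (- v * a ^+ 2))%:E * (Num.sqrt (pi / v) ^+ n)%:E))%E.
  apply: eq_integral => a _; rewrite -IH -ge0_integralZl//.
  - by apply: eq_integral => w _; rewrite dotv_cons mulrDr expRD EFinM expr2.
  - exact: emeasurable_gauss_rV.
rewrite ge0_integralZr//.
- by rewrite integral_gauss// -EFinM exprS.
- by apply: (measurable_int leb); exact: integrable_gauss.
Qed.

Lemma integrable_gauss_rV n (v : R) : 0 < v ->
  (lebesgue_rV R n).-integrable setT
    (EFin \o (fun xi => expR (- v * dotv xi xi))).
Proof.
move=> v0; apply/integrableP; split.
  exact: emeasurable_gauss_rV.
under eq_integral do rewrite /= ger0_norm ?expR_ge0//.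
by rewrite integral_gauss_rV// ltry.
Qed.

Lemma measurable_cos_dotv n (x : 'rV[R]_n) (th : R) :
  measurable_fun setT (fun xi => cos (dotv xi x + th)).
Proof.
apply: measurableT_comp.
  by apply: continuous_measurable_fun; exact: continuous_cos.
by apply: measurable_funD => //; exact: measurable_dotv.
Qed.

Lemma integrable_gauss_rV_cos n (v : R) x th : 0 < v ->
  (lebesgue_rV R n).-integrable setT
    (EFin \o (fun xi => expR (- v * dotv xi xi) * cos (dotv xi x + th))).
Proof.
move=> v0; apply: integrable_dominated (integrable_gauss_rV _ v0) _.
  by apply: measurable_funM; [exact: measurable_gauss_rV|exact: measurable_cos_dotv].
by move=> a; rewrite normrM (ger0_norm (expR_ge0 _)) ler_piMr ?expR_ge0// cos_max.
Qed.

(** For a fixed first coordinate a, the term a * x_0 joins the phase and the induction hypothesis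
    applies to the other coordinates; the cosine it leaves is integrated over a by the
    one-dimensional formula. *)
Lemma integral_gauss_rV_cos n (v : R) (x : 'rV[R]_n) (th : R) : 0 < v ->
  (\int[lebesgue_rV R n]_xi
     (expR (- v * dotv xi xi) * cos (dotv xi x + th))%:E =
   (Num.sqrt (pi / v) ^+ n * expR (- dotv x x / (4 * v)) * cos th)%:E)%E.
Proof.
move=> v0; elim: n x th => [|n IH] x th.
  rewrite integral_rV0.
    rewrite dotvC !dotv0 mulr0 expR0 add0r expr0.
    by rewrite /dotv big_ord0 oppr0 mul0r expR0 !mul1r.
  apply/measurable_EFinP/measurable_funM; first exact: measurable_gauss_rV.
  exact: measurable_cos_dotv.
rewrite integral_rVS; last exact: integrable_gauss_rV_cos.
pose x' : 'rV[R]_n := \row_j x ord0 (lift ord0 j).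
have xE : x = cons_rV (x ord0 ord0, x') by rewrite cons_rV_head_tail.
pose c := Num.sqrt (pi / v) ^+ n * expR (- dotv x' x' / (4 * v)).
transitivity (\int[leb]_a (c%:E * (expR (- v * a ^+ 2) * cos (a * x ord0 ord0 + th))%:E))%E.
  apply: eq_integral => a _.
  transitivity (\int[lebesgue_rV R n]_w ((expR (- v * a ^+ 2))%:E *
    (expR (- v * dotv w w) * cos (dotv w x' + (a * x ord0 ord0 + th)))%:E))%E.
    apply: eq_integral => w _; rewrite xE !dotv_cons -EFinM; congr EFin.
    rewrite mulrDr expRD -mulrA expr2; congr (_ * (_ * cos _)).
    by rewrite mxE unlift_none/=; ring.
  rewrite integralZl//; last exact: integrable_gauss_rV_cos.
  by rewrite IH -!EFinM; congr EFin; rewrite /c; ring.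
rewrite integralZl//.
  rewrite integral_gauss_cos// -EFinM; congr EFin.
  have -> : dotv x x = x ord0 ord0 ^+ 2 + dotv x' x' by rewrite [in LHS]xE dotv_cons.
  rewrite /c [- (_ + _) / _](_ : _ = - x ord0 ord0 ^+ 2 / (4 * v) +
    - dotv x' x' / (4 * v)); last by rewrite -mulrDl opprD.
  by rewrite expRD [_ ^+ n.+1]exprS; ring.
exact: integrable_gauss_cos.
Qed.

End gauss_rV.

(** * Completely monotone functions *)

Section completely_monotone.
Context (R : realType) (n : nat).
Local Notation lebn := (lebesgue_rV R n).
Implicit Types (F G : R -> R) (s : seq (R * R)) (m : 'rV[R]_n -> R).

(* The functional F |-> L s m F is a signed combination of evaluations of F at
   nonnegative points. *)
Let L s m F := \sum_(cl <- s) cl.1 * F cl.2 +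
  \int[lebn]_xi (m xi * F (dotv xi xi)).

Let admissible s m := [/\ {in s, forall cl : R * R, 0 <= cl.2},
  lebn.-integrable setT (EFin \o m) &
  forall v, 0 <= v -> 0 <= L s m (fun l => expR (- v * l))].

(* By Bernstein's theorem this says that F is completely monotone; the
   definition by duality makes the closure properties below immediate. *)
Definition bernstein F := [/\
  measurable_fun setT (fun xi : 'rV[R]_n => F (dotv xi xi)),
  exists B, forall l, 0 <= l -> `|F l| <= B &
  forall s m, admissible s m -> 0 <= L s m F].

Let integrable_bernstein m F : lebn.-integrable setT (EFin \o m) ->
  measurable_fun setT (fun xi : 'rV[R]_n => F (dotv xi xi)) ->
  (exists B, forall l, 0 <= l -> `|F l| <= B) ->
  lebn.-integrable setT (EFin \o (fun xi => m xi * F (dotv xi xi))).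
Proof.
move=> im mF [B FB].
have mm : measurable_fun setT m by apply/measurable_EFinP; exact: measurable_int im.
apply: (@integrable_dominated _ _ _ lebn _ (fun xi => B * `|m xi|)).
- exact: measurable_funM.
- exact: (integrableZl_EFin _ (integrable_abse im)).
- by move=> xi; rewrite normrM mulrC ler_wpM2r// FB// dotvv_ge0.
Qed.

Lemma bernstein_exp (v : R) : 0 <= v -> bernstein (fun l => expR (- v * l)).
Proof.
move=> v0; split; last by move=> s m []; move=> _ _; exact.
  apply: measurableT_comp => //; apply: measurable_funM => //.
  exact: measurable_dotv.
exists 1 => l l0; rewrite ger0_norm ?expR_ge0// expR_le1 mulNr oppr_le0.
exact: mulr_ge0.
Qed.

Lemma bernsteinD F G : bernstein F -> bernstein G ->
  bernstein (fun l => F l + G l).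
Proof.
move=> [mF [B FB] F0] [mG [C GC] G0]; split.
- exact: measurable_funD.
- by exists (B + C) => l l0; rewrite (le_trans (ler_normD _ _))// lerD ?FB ?GC.
move=> s m adm; have [_ im _] := adm.
rewrite (_ : L s m _ = L s m F + L s m G); first by rewrite addr_ge0 ?F0 ?G0.
rewrite /L addrACA -big_split/=; congr (_ + _).
  by apply: eq_bigr => cl _; rewrite mulrDr.
rewrite -RintegralD//; first by apply: eq_Rintegral => xi _; rewrite mulrDr.
  by apply: integrable_bernstein => //; exists B.
by apply: integrable_bernstein => //; exists C.
Qed.

Lemma bernsteinZ (c : R) F : 0 <= c -> bernstein F -> bernstein (fun l => c * F l).
Proof.
move=> c0 [mF [B FB] F0]; split.
- exact: measurable_funM.
- by exists (c * B) => l l0; rewrite normrM ger0_norm// ler_wpM2l// FB.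
move=> s m adm; have [_ im _] := adm.
rewrite (_ : L s m _ = c * L s m F); first by rewrite mulr_ge0 ?F0.
rewrite /L mulrDr mulr_sumr; congr (_ + _).
  by apply: eq_bigr => cl _; rewrite mulrCA.
rewrite -RintegralZl//; first by apply: eq_Rintegral => xi _; rewrite mulrCA.
by apply: integrable_bernstein => //; exists B.
Qed.

(* Multiplying the weights of an admissible functional by a completely monotone
   function gives an admissible functional again. *)
Lemma bernsteinM F G : bernstein F -> bernstein G ->
  bernstein (fun l => F l * G l).
Proof.
move=> [mF [B FB] F0] [mG [C GC] G0]; split.
- exact: measurable_funM.
- by exists (B * C) => l l0; rewrite normrM ler_pM ?FB ?GC.
have LM s m H K : L s m (fun l => H l * K l) =
    L [seq (cl.1 * H cl.2, cl.2) | cl <- s] (fun xi => m xi * H (dotv xi xi)) K.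
  rewrite /L big_map/=; congr (_ + _); first by apply: eq_bigr => cl _; rewrite mulrA.
  by apply: eq_Rintegral => xi _; rewrite mulrA.
move=> s m [s0 im adm]; rewrite LM; apply: G0; split.
- by move=> _ /mapP[cl cls ->]/=; exact: s0.
- by apply: integrable_bernstein => //; exists B.
(* The weights multiplied by F must be tested against exp(- v l). This amounts to applying F to the
   weights multiplied by exp(- v l), which stay admissible because a product of two exponentials is
   an exponential. *)
move=> v v0; rewrite -LM.
rewrite (_ : L s m _ = L s m (fun l => expR (- v * l) * F l)); last first.
  by congr (L s m _); apply/funext => l; rewrite mulrC.
rewrite LM; apply: F0; have [mv bv _] := bernstein_exp v0; split.
- by move=> _ /mapP[cl cls ->]/=; exact: s0.
- exact: (@integrable_bernstein m (fun l => expR (- v * l))).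
move=> w w0; rewrite -(LM s m (fun l => expR (- v * l))).
rewrite (_ : L s m _ = L s m (fun l => expR (- (v + w) * l))).
  by apply: adm; exact: addr_ge0.
by congr (L s m _); apply/funext => l; rewrite -expRD -mulrDl opprD.
Qed.

Lemma bernstein_cst (c : R) : 0 <= c -> bernstein (cst c).
Proof.
move=> c0; have := bernsteinZ c0 (bernstein_exp (lexx 0)).
by under [X in bernstein X]eq_fun do rewrite oppr0 mul0r expR0 mulr1.
Qed.

Lemma bernsteinX F k : bernstein F -> bernstein (fun l => F l ^+ k).
Proof.
move=> bF; elim: k => [|k IH].
  by under eq_fun do rewrite expr0; exact: bernstein_cst.
by under eq_fun do rewrite exprS; exact: bernsteinM.
Qed.

Lemma bernstein_sum (F_ : nat -> R -> R) k : (forall i, bernstein (F_ i)) ->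
  bernstein (fun l => \sum_(i < k) F_ i l).
Proof.
move=> bF; elim: k => [|k IH].
  by under eq_fun do rewrite big_ord0; exact: bernstein_cst.
by under eq_fun do rewrite big_ord_recr/=; exact: bernsteinD.
Qed.

(** Every admissible functional passes to the limit: its finite sum termwise, its integral by
    dominated convergence with majorant B |m|, which is why a bound uniform in i is required. *)
Lemma bernstein_lim (F_ : nat -> R -> R) F B : (forall i, bernstein (F_ i)) ->
  (forall i l, 0 <= l -> `|F_ i l| <= B) ->
  (forall l, 0 <= l -> F_ i l @[i --> \oo] --> F l) -> bernstein F.
Proof.
move=> bF FB FF; split.
- apply: (measurable_fun_cvg (h := fun i xi => F_ i (dotv xi xi))) => [i|xi _].
    by have [] := bF i.
  by apply: FF; exact: dotvv_ge0.
- exists B => l l0; apply: (cvgr_to_le (cvg_norm (FF l l0))).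
  by apply: nearW => i; exact: FB.
move=> s m adm; have [s0 im _] := adm.
have mm : measurable_fun setT m by apply/measurable_EFinP; exact: measurable_int im.
have LF : L s m (F_ i) @[i --> \oo] --> L s m F.
  apply: cvgD.
    elim: s s0 {adm} => [|cl s IH] s0.
      by rewrite big_nil; under eq_fun do rewrite big_nil; exact: cvg_cst.
    rewrite big_cons; under eq_fun do rewrite big_cons.
    apply: cvgD; last by apply: IH => c cs; apply: s0; rewrite inE cs orbT.
    by apply: cvgM; [exact: cvg_cst|apply: FF; apply: s0; rewrite mem_head].
  apply: (dominated_cvg_Rintegral (g := fun xi => B * `|m xi|)).
  - by move=> i; apply: measurable_funM => //; have [] := bF i.
  - by move=> xi; apply: cvgM; [exact: cvg_cst|apply: FF; exact: dotvv_ge0].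
  - exact: (integrableZl_EFin _ (integrable_abse im)).
  - by move=> i xi; rewrite normrM mulrC ler_wpM2r// FB// dotvv_ge0.
apply: (cvgr_to_ge LF).
by apply: nearW => i; have [_ _] := bF i; exact.
Qed.

(** The form used outside the section, with the local [L] and [admissible] spelled out: an
    inequality checked on exponentials passes to F. *)
Lemma bernsteinP F s m : bernstein F -> {in s, forall cl : R * R, 0 <= cl.2} ->
  lebn.-integrable setT (EFin \o m) ->
  (forall v, 0 <= v -> 0 <= \sum_(cl <- s) cl.1 * expR (- v * cl.2) +
    \int[lebn]_xi (m xi * expR (- v * dotv xi xi))) ->
  0 <= \sum_(cl <- s) cl.1 * F cl.2 + \int[lebn]_xi (m xi * F (dotv xi xi)).
Proof. by move=> [_ _ F0] s0 im h; exact: F0. Qed.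

End completely_monotone.

(** * The binomial series of 1 - (1 - w)^b *)

Section binomial_series.
Context (R : realType) (b : R).
Hypothesis b01 : 0 < b < 1.

(* The coefficients in 1 - (1 - w)^b = \sum_k bcoef k w^(k+1). *)
Fixpoint bcoef (k : nat) : R :=
  if k is j.+1 then bcoef j * (j.+1%:R - b) / j.+2%:R else b.

Let bcoef_gt0 k : 0 < bcoef k.
Proof.
elim: k => [|k IH] /=; first by case/andP: b01.
rewrite divr_gt0// mulr_gt0// subr_gt0.
by case/andP: b01 => _ /lt_le_trans; apply; rewrite ler1n.
Qed.

Let bcoefS k : k.+2%:R * bcoef k.+1 = (k.+1%:R - b) * bcoef k.
Proof. by rewrite /= mulrCA divff ?pnatr_eq0// mulr1 mulrC. Qed.

(** Bounds the error term in [P_ode] by b w^K for w >= 0. *)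
Let bcoef_le k : k.+1%:R * bcoef k <= b.
Proof.
elim: k => [|k IH]; first by rewrite mul1r.
rewrite bcoefS (le_trans _ IH)// ler_pM2r// gerBl.
by case/andP: b01 => /ltW.
Qed.

Let bcoef0 : bcoef 0 = b. Proof. by []. Qed.

#[local] Arguments bcoef : simpl never.

Let P K w := \sum_(k < K) bcoef k * w ^+ k.+1.

Let P' K w := \sum_(k < K) k.+1%:R * bcoef k * w ^+ k.

Let is_derive_P K (w : R) : is_derive w (1 : R) (P K) (P' K w).
Proof.
rewrite /P; elim: K => [|K IH].
  under eq_fun do rewrite big_ord0; rewrite /P' big_ord0; exact: is_derive_cst.
under eq_fun do rewrite big_ord_recr/=.
rewrite /P' big_ord_recr/=; apply: is_deriveD.
have dX : is_derive w (1 : R) (fun w => w ^+ K.+1) (K.+1%:R * w ^+ K).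
  have d := is_deriveX K.+1 (is_derive_id w (1 : R)).
  rewrite exprfctE in d.
  by apply: is_derive_eq; rewrite /GRing.scale/= mulr1.
apply: is_derive_eq; rewrite /GRing.scale/=.
by ring.
Qed.

(** The function f = (1 - w)^b solves (1 - w) f' = - b f. The truncation 1 - P K solves it up to a
    single term, since by [bcoefS] all other terms telescope. *)
Let P_ode K w : (1 - w) * P' K w + (K.+1%:R * bcoef K) * w ^+ K = b * (1 - P K w).
Proof.
rewrite /P /P'; elim: K => [|K IH].
  by rewrite !big_ord0 expr0 bcoef0; ring.
rewrite !big_ord_recr/=; move: IH; set A := \sum_(k < K) _; set S := \sum_(k < K) _.
move=> IH; rewrite bcoefS.
have -> : b * (1 - (S + bcoef K * w ^+ K.+1)) = b * (1 - S) - b * (bcoef K * w ^+ K.+1) by ring.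
by rewrite -IH !exprS; ring.
Qed.

(** [Phi] compares 1 - P K with (1 - z)^b. By [P_ode] its derivative is one nonnegative term, so the
    mean value theorem gives the lower bound from its sign and the upper bound from its size, which
    is largest at w. At w = 0 the mean value interval would be empty. *)
Let P_bounds K (w : R) : 0 <= w < 1 ->
  (1 - w) `^ b <= 1 - P K w <= (1 - w) `^ b + b * w ^+ K / (1 - w).
Proof.
move=> /andP[w0 w1]; case/andP: (b01) => b0 b1.
have w1' : 0 < 1 - w by rewrite subr_gt0.
move: w0; rewrite le_eqVlt => /orP[/eqP w0|w0].
  rewrite -w0 subr0 powR1 (_ : P K 0 = 0) ?subr0 ?lexx/=; last first.
    by apply: big1 => k _; rewrite exprS mul0r mulr0.
  by rewrite invr1 mulr1 lerDl mulr_ge0 ?exprn_ge0// ltW.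
pose Phi z := (1 - P K z) * (1 - z) `^ (- b).
pose Phi' z := (K.+1%:R * bcoef K) * z ^+ K * (1 - z) `^ (- b - 1).
have dPhi z : z \in `]0, w[ -> is_derive z (1 : R) Phi (Phi' z).
  rewrite in_itv/= => /andP[z0 zw].
  have z1 : 0 < 1 - z by rewrite subr_gt0 (lt_trans zw).
  have dpow : is_derive z (1 : R) (fun z => (1 - z) `^ (- b)) (b * (1 - z) `^ (- b - 1)).
    have d1 : is_derive z (1 : R) (fun z : R => 1 - z) (-1).
      by apply: is_derive_eq; rewrite add0r mul1r.
    have d2 := is_derive1_powR (- b) z1.
    have d3 := @is_derive1_comp R (@powR R ^~ (- b)) (fun z => 1 - z) _ _ _ d2 d1.
    by rewrite mulrN1 mulNr opprK in d3.
  have dP := is_derive_P K z.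
  apply: is_derive_eq; rewrite /GRing.scale/=.
  have -> : (1 - z) `^ (- b) = (1 - z) * (1 - z) `^ (- b - 1).
    rewrite -{2}[1 - z]powRr1 ?ltW// -powRD ?(gt_eqF z1) ?implybT//.
    by congr (_ `^ _); ring.
  have E : K.+1%:R * bcoef K * z ^+ K = b * (1 - P K z) - (1 - z) * P' K z.
    by rewrite -P_ode; ring.
  by rewrite /Phi' E; ring.
have [c cw PhiE] : exists2 c, c \in `]0, w[ & Phi w - Phi 0 = Phi' c * (w - 0).
  apply: MVT => //; apply: derivable_within_continuous => z.
  rewrite in_itv/= => /andP[z0 zw].
  have z1 : 0 < 1 - z by rewrite subr_gt0 (le_lt_trans zw).
  have d1 : is_derive z (1 : R) (fun z : R => 1 - z) (-1).
    by apply: is_derive_eq; rewrite add0r mul1r.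
  have d2 := is_derive1_powR (- b) z1.
  have d3 := @is_derive1_comp R (@powR R ^~ (- b)) (fun z => 1 - z) _ _ _ d2 d1.
  have dP := is_derive_P K z.
  by apply: ex_derive.
move: cw; rewrite in_itv/= => /andP[c0 cw].
have c1 : 0 < 1 - c by rewrite subr_gt0 (lt_trans cw).
have Phi0 : Phi 0 = 1.
  rewrite /Phi subr0 powR1 mulr1 /P big1 ?subr0// => k _.
  by rewrite exprS mul0r mulr0.
have PhiwE : (1 - P K w) = Phi w * (1 - w) `^ b.
  by rewrite /Phi -mulrA -powRD ?(gt_eqF w1') ?implybT// addNr powRr0 mulr1.
have {}PhiE : Phi w = 1 + Phi' c * w.
  by rewrite -(subrK (Phi 0) (Phi w)) PhiE Phi0 subr0 addrC.
have Phi'0 : 0 <= Phi' c.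
  by rewrite /Phi' !mulr_ge0 ?exprn_ge0 ?powR_ge0// ltW.
rewrite PhiwE PhiE mulrDl mul1r lerDl lerD2l.
rewrite (mulr_ge0 (mulr_ge0 Phi'0 (ltW w0)) (powR_ge0 _ _))/=.
have h1 : Phi' c <= b * w ^+ K * (1 - w) `^ (- b - 1).
  have cK0 : 0 <= c ^+ K by rewrite exprn_ge0// ltW.
  have a0 : 0 <= K.+1%:R * bcoef K by rewrite mulr_ge0// ltW.
  rewrite /Phi' !ler_pM ?powR_ge0 ?(mulr_ge0 a0)//.
    by rewrite lerXn2r ?nnegrE ?ltW.
  rewrite (_ : - b - 1 = - (b + 1)); last by rewrite opprD.
  rewrite !powRN lef_pV2 ?posrE ?powR_gt0// ge0_ler_powR ?nnegrE ?ltW//.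
  - by rewrite addr_gt0.
  - by rewrite ltrD2l ltrN2.
have -> : b * w ^+ K / (1 - w) = b * w ^+ K * (1 - w) `^ (- b - 1) * (1 - w) `^ b.
  rewrite -[RHS]mulrA -powRD ?(gt_eqF w1') ?implybT//.
  by rewrite (_ : - b - 1 + b = -1) ?powR_inv1 ?(ltW w1')//; ring.
rewrite ler_pM2r ?powR_gt0// (le_trans _ h1)// ler_piMr ?(ltW w1) ?(le_trans Phi'0)//.
Qed.

Lemma cvg_binomial_series (w : R) : 0 <= w < 1 ->
  \sum_(k < K) bcoef k * w ^+ k.+1 @[K --> \oo] --> 1 - (1 - w) `^ b.
Proof.
move=> w01; case/andP: (w01) => w0 w1.
have cw : 1 - (1 - w) `^ b - b * w ^+ K / (1 - w) @[K --> \oo] --> 1 - (1 - w) `^ b.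
  rewrite -[X in _ --> X]subr0; apply: cvgB; first exact: cvg_cst.
  rewrite -(mul0r (1 - w)^-1); apply: cvgM; last exact: cvg_cst.
  rewrite -(mulr0 b); apply: cvgM; first exact: cvg_cst.
  by apply: cvg_expr; rewrite ger0_norm.
apply: squeeze_cvgr cw (cvg_cst _).
by apply: nearW => K; have := P_bounds K w01; rewrite /P; lra.
Qed.

Lemma binomial_partial_bounds K (w : R) : 0 <= w < 1 ->
  0 <= \sum_(k < K) bcoef k * w ^+ k.+1 <= 1.
Proof.
move=> w01; case/andP: (w01) => w0 w1.
rewrite sumr_ge0/=; last by move=> k _; rewrite mulr_ge0 ?exprn_ge0// ltW.
have /andP[h _] := P_bounds K w01.
by rewrite -subr_ge0 (le_trans _ h)// powR_ge0.
Qed.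

Lemma bcoef_ge0 k : 0 <= bcoef k. Proof. exact: ltW. Qed.

End binomial_series.

(** * Complete monotonicity of exp(- t l^b) *)

Section bernstein_powR.
Context (R : realType).

Lemma cvg_powR (u : nat -> R) (l b : R) : 0 < b -> 0 <= l ->
  (forall i, 0 <= u i) -> u i @[i --> \oo] --> l ->
  u i `^ b @[i --> \oo] --> l `^ b.
Proof.
(* The power need not be differentiable at l = 0; there u < e^(1/b) gives u^b <= e directly. *)
move=> b0 l0 u0 ul; move: l0; rewrite le_eqVlt => /orP[/eqP l0|l0].
  rewrite -l0 powR0 ?gt_eqF//; apply/cvgrPdist_le => /= e e0.
  have e0' : 0 < e `^ b^-1 by rewrite powR_gt0.
  move/cvgrPdist_le : ul => /(_ _ e0'); apply: filterS => i /=.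
  rewrite -l0 !sub0r !normrN !ger0_norm ?powR_ge0// => ui.
  have : u i `^ b <= (e `^ b^-1) `^ b.
    by apply: (ge0_ler_powR (ltW b0)) => //; rewrite nnegrE// ltW.
  by rewrite -powRrM mulVf ?gt_eqF// powRr1// ltW.
have c : {for l, continuous (@powR R ^~ b)}.
  apply/differentiable_continuous/derivable1_diffP.
  by apply: derivable_powR; rewrite in_itv/= l0.
exact: (continuous_cvg _ c ul).
Qed.

(** With z = y / (J + 1), the squeeze is exp(- z / (1 - z)) <= 1 - z <= exp(- z); the left
    inequality is 1 + x <= exp x at x = z / (1 - z). *)
Lemma cvg_1Bdivn (y : R) : 0 <= y ->
  (1 - y / J.+1%:R) ^+ J.+1 @[J --> \oo] --> expR (- y).
Proof.
move=> y0.
have h0 : y / J.+1%:R @[J --> \oo] --> (0 : R).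
  rewrite -(mulr0 y); apply: cvgM; [exact: cvg_cst|exact: cvg_harmonic].
apply: (@squeeze_cvgr _ _ _ _ (fun J => expR (- (y / (1 - y / J.+1%:R))))
  (cst (expR (- y)))); last 2 first.
- rewrite -[y in X in _ --> X]divr1 -[1 in X in _ --> X]subr0.
  apply: continuous_cvg; first exact: continuous_expR.
  apply: cvgN; apply: cvgM; first exact: cvg_cst.
  apply: cvgV; first by rewrite subr0.
  by apply: cvgB; [exact: cvg_cst|exact: h0].
- exact: cvg_cst.
near=> J.
have y1 : y / J.+1%:R < 1 by near: J; apply: (cvgr_lt _ h0); exact: ltr01.
move: y1; set N : R := J.+1%:R => y1; have N0 : 0 < N by [].
have z0 : 0 <= y / N by rewrite divr_ge0// ltW.
have d0 : 0 < 1 - y / N by rewrite subr_gt0.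
have pw z : expR (- (z * N)) = expR (- z) ^+ J.+1.
  by rewrite -mulNr expRM_natr.
apply/andP; split; last first.
  rewrite /= -[y in leRHS](divfK (lt0r_neq0 N0)) pw lerXn2r ?nnegrE ?expR_ge0 ?(ltW d0)//.
  exact: expR_ge1Dx.
rewrite (_ : y / (1 - y / N) = (y / N / (1 - y / N)) * N); last first.
  by rewrite mulrAC divfK ?gt_eqF.
rewrite pw lerXn2r ?nnegrE ?expR_ge0 ?(ltW d0)//.
rewrite expRN invf_ple ?posrE ?expR_gt0//.
apply: le_trans (expR_ge1Dx _).
rewrite le_eqVlt; apply/orP; left; apply/eqP.
by clear -d0; move: (y / N) d0 => z d0; field; rewrite gt_eqF.
Unshelve. all: end_near. Qed.

(** Three limits are nested. The series makes A = 1 - (1 - w)^b completely monotone; exp(- T (1 -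
    w)^b) is the limit of the powers (1 - T / J + (T / J) A)^J, which have nonnegative coefficients
    once J >= T; finally T = t N^b and N (1 - w) tends to l. *)
Lemma bernstein_expR_powR n (t b : R) : 0 <= t -> 0 < b < 1 ->
  bernstein n (fun l => expR (- t * l `^ b)).
Proof.
move=> t0 b01; case/andP: (b01) => b0 b1.
(* w i l = exp (- (l + 1/N) / N) with N = i + 1: the shift 1/N keeps w < 1. *)
pose w i (l : R) := expR (- (l / i.+1%:R + i.+1%:R^-1 ^+ 2)).
have w01 i l : 0 <= l -> 0 <= w i l < 1.
  move=> l0; rewrite /w expR_ge0/= expR_lt1 oppr_lt0.
  by apply: ltr_wpDl; [rewrite divr_ge0|rewrite exprn_gt0// invr_gt0].
have bw i : bernstein n (w i).
  have h1 : 0 <= i.+1%:R^-1 :> R by rewrite invr_ge0.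
  have := bernsteinZ (expR_ge0 (- i.+1%:R^-1 ^+ 2)) (bernstein_exp n h1).
  congr bernstein; apply/funext => l.
  by rewrite -expRD /w opprD addrC mulNr [l / _]mulrC.
pose A i l := 1 - (1 - w i l) `^ b.
have bA i : bernstein n (A i).
  apply: (@bernstein_lim _ _ (fun K l => \sum_(k < K) bcoef b k * w i l ^+ k.+1) _ 1).
  - move=> K; apply: (@bernstein_sum _ _ (fun k l => bcoef b k * w i l ^+ k.+1)) => k.
    by apply: bernsteinZ; [exact: bcoef_ge0|exact: bernsteinX].
  - move=> K l l0; have /andP[h1 h2] := binomial_partial_bounds b01 K (w01 i l l0).
    by rewrite ger0_norm.
  - by move=> l l0; apply: (cvg_binomial_series b01); exact: w01.
have A01 i l : 0 <= l -> 0 <= (1 - w i l) `^ b <= 1.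
  move=> l0; have /andP[w0 w1] := w01 i l l0; rewrite powR_ge0/=.
  rewrite [leRHS](_ : 1 = 1 `^ b); last by rewrite powR1.
  apply: (ge0_ler_powR (ltW b0)); rewrite ?nnegrE ?subr_ge0 ?(ltW w1) ?gerBl//.
pose T i := t * i.+1%:R `^ b.
have T0 i : 0 <= T i by rewrite mulr_ge0 ?powR_ge0.
have bE i : bernstein n (fun l => expR (- (T i * (1 - w i l) `^ b))).
  (* Shifting the index by [j0] guarantees J >= T from the start, so that 1 - T / J >= 0 for every
     j. *)
  pose j0 := Num.bound (T i).
  have jT j : T i / (j + j0).+1%:R <= 1.
    rewrite ler_pdivrMr// mul1r ltW// (lt_le_trans (archi_boundP (T0 i)))//.
    by rewrite ler_nat leqW// leq_addl.
  apply: (@bernstein_lim _ _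
    (fun j l => (1 - T i * (1 - w i l) `^ b / (j + j0).+1%:R) ^+ (j + j0).+1) _ 1).
  - move=> j; apply: bernsteinX.
    have h1 : 0 <= 1 - T i / (j + j0).+1%:R by rewrite subr_ge0.
    have h2 : 0 <= T i / (j + j0).+1%:R by rewrite divr_ge0.
    have := bernsteinD (bernstein_cst n h1) (bernsteinZ h2 (bA i)).
    congr bernstein; apply/funext => l; rewrite /A /=.
    by ring.
  - move=> j l l0; have /andP[p0 p1] := A01 i l l0.
    have h1 : 0 <= 1 - T i * (1 - w i l) `^ b / (j + j0).+1%:R.
      rewrite subr_ge0 (le_trans _ (jT j))// ler_pM2r ?invr_gt0//.
      by rewrite ler_piMr.
    rewrite ger0_norm ?exprn_ge0// exprn_ile1// gerBl.
    by rewrite divr_ge0// mulr_ge0.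
  - move=> l l0; have /andP[p0 p1] := A01 i l l0.
    apply: (cvg_comp (fun j => (j + j0)%N)
      (fun J => (1 - T i * (1 - w i l) `^ b / J.+1%:R) ^+ J.+1)).
      exact: cvg_addnr.
    by apply: cvg_1Bdivn; rewrite mulr_ge0.
apply: (bernstein_lim bE (B := 1)) => [i l l0|l l0].
  by rewrite ger0_norm ?expR_ge0// expR_le1 oppr_le0 mulr_ge0 ?powR_ge0.
rewrite mulNr; apply: continuous_cvg; first exact: continuous_expR.
apply: cvgN; rewrite /T; under eq_fun do rewrite -mulrA.
apply: cvgM; first exact: cvg_cst.
under eq_fun => i.
  rewrite -powRM//; last by have /andP[_ /ltW] := w01 i l l0; rewrite subr_ge0.
  over.
apply: cvg_powR => //.
  move=> i; rewrite mulr_ge0//; by have /andP[_ /ltW] := w01 i l l0; rewrite subr_ge0.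
have hc : (l + i.+1%:R^-1) @[i --> \oo] --> l.
  rewrite -[X in _ --> X]addr0; apply: cvgD; [exact: cvg_cst|exact: cvg_harmonic].
(* With x = l + 1/N one has w = exp(- x / N), and N (1 - w) lies between x / (1 + x / N) and x. *)
apply: (@squeeze_cvgr _ _ _ _
  (fun i => (l + i.+1%:R^-1) / (1 + (l + i.+1%:R^-1) * i.+1%:R^-1))
  (fun i => l + i.+1%:R^-1)) => //; last first.
  have -> : l = l / (1 + l * 0) by rewrite mulr0 addr0 divr1.
  rewrite [in X in X @ _](_ : l / (1 + l * 0) = l); last by rewrite mulr0 addr0 divr1.
  apply: cvgM; first exact: hc.
  apply: cvgV; first by rewrite mulr0 addr0.
  apply: cvgD; first exact: cvg_cst.
  by apply: cvgM; [exact: hc|exact: cvg_harmonic].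
apply: nearW => i; rewrite /w.
have -> : l / i.+1%:R + i.+1%:R^-1 ^+ 2 = (l + i.+1%:R^-1) * i.+1%:R^-1 by ring.
have N0 : 0 < i.+1%:R :> R by [].
set N : R := i.+1%:R; set x := l + N^-1.
have x0 : 0 < x by rewrite ltr_wpDl// invr_gt0.
have h1 := expR_ge1Dx (x / N); have h2 := expR_ge1Dx (- (x / N)).
have d0 : 0 < 1 + x / N by rewrite addr_gt0// divr_gt0.
apply/andP; split; last first.
  apply: (@le_trans _ _ (N * (x / N))); last by rewrite mulrCA divff ?mulr1// gt_eqF.
  by rewrite ler_pM2l// lerBlDr addrC -lerBlDr.
apply: (@le_trans _ _ (N * (1 - (1 + x / N)^-1))).
  rewrite le_eqVlt; apply/orP; left; apply/eqP.
  have h y : 0 < 1 + y -> y * N / (1 + y) = N * (1 - (1 + y)^-1).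
    by clear; move=> y0; field; rewrite gt_eqF.
  by rewrite -(h _ d0) divfK// gt_eqF.
rewrite ler_pM2l// lerD2l lerN2 expRN lef_pV2 ?posrE ?expR_gt0//.
Qed.

End bernstein_powR.

(** * Comparison with the heat kernel *)

Section gauss_inequalities.
Context (R : realType).

Lemma expRN_le_inv (x : R) : 0 <= x -> expR (- x) <= (1 + x)^-1.
Proof.
move=> x0; rewrite expRN lef_pV2 ?posrE ?expR_gt0 ?expR_ge1Dx//.
by rewrite ltr_wpDr.
Qed.

Lemma expRN_le_quad (x : R) : 0 <= x -> expR (- x) <= 1 - x + x ^+ 2.
Proof.
move=> x0; apply: (le_trans (expRN_le_inv x0)).
rewrite -[leLHS]mul1r ler_pdivrMr ?ltr_wpDr//.
by have := exprn_ge0 3 x0; rewrite !exprS expr0; nra.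
Qed.

Lemma exprn_le_expR (n : nat) (x : R) : 0 <= x -> x ^+ n <= n`!%:R * expR x.
Proof.
case: n => [|n] x0.
  by rewrite expr0 fact0 mul1r -expR0 ler_expR.
rewrite mulrC -ler_pdivrMr ?ltr0n ?fact_gt0//.
by apply: le_trans (expR_ge1Dxn n x0); rewrite lerDr.
Qed.

Lemma exprn_le_expRM (n : nat) (a : R) : 0 < a -> exists2 K, 0 < K &
  forall x, 0 <= x -> (1 + x) ^+ n <= K * expR (a * x).
Proof.
move=> a0; exists (n`!%:R * expR a / a ^+ n).
  by rewrite divr_gt0 ?exprn_gt0// mulr_gt0 ?expR_gt0// ltr0n fact_gt0.
move=> x x0; rewrite mulrAC ler_pdivlMr ?exprn_gt0// -exprMn.
have h : 0 <= (1 + x) * a by rewrite mulr_ge0 ?addr_ge0// ltW.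
apply: (le_trans (exprn_le_expR n h)).
by rewrite -mulrA -expRD (_ : a + a * x = (1 + x) * a)//; ring.
Qed.

Lemma sqrtr_le1D (x : R) : 0 <= x -> Num.sqrt x <= 1 + x.
Proof.
by move=> x0; have := sqr_sqrtr x0; have := sqrtr_ge0 x; nra.
Qed.

Variable d : nat.

(** In terms of w = 1/v, the right-hand side is at least C / (1 + w) and v^(-d/2) <= (1 + w)^d, so
    the claim reduces to (1 + w)^(d+1) <= K exp(w / 4). *)
Lemma gauss_le_1BexpR : exists2 C, 0 < C & forall v : R, 0 < v ->
  Num.sqrt v ^- d * expR (- (4 * v)^-1) <= C * (1 - expR (- v)).
Proof.
have a0 : 0 < 4^-1 :> R by rewrite invr_gt0.
have [K K0 HK] := exprn_le_expRM d.+1 a0.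
exists K => // v v0.
pose w := v^-1; have w0 : 0 < w by rewrite invr_gt0.
have w1 : 0 < 1 + w by rewrite addr_gt0.
have h1 : (1 + w)^-1 <= 1 - expR (- v).
  have := expRN_le_inv (ltW v0).
  have -> : (1 + w)^-1 = 1 - (1 + v)^-1.
    rewrite /w; field; rewrite !gt_eqF ?addr_gt0//.
  lra.
have h2 : Num.sqrt v ^- d <= (1 + w) ^+ d.
  rewrite -exprVn -sqrtrV ?(ltW v0)// lerXn2r ?nnegrE ?sqrtr_ge0 ?(ltW w1)//.
  by apply: sqrtr_le1D; exact: ltW.
have h3 : expR (- (4 * v)^-1) <= K / (1 + w) ^+ d.+1.
  rewrite ler_pdivlMr ?exprn_gt0// mulrC invfM -/w.
  rewrite expRN -ler_pdivlMr ?invr_gt0 ?expR_gt0// invrK.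
  exact: HK (ltW w0).
apply: (@le_trans _ _ ((1 + w) ^+ d * (K / (1 + w) ^+ d.+1))).
  by apply: ler_pM => //; rewrite ?expR_ge0// invr_ge0 exprn_ge0 ?sqrtr_ge0.
rewrite mulrCA ler_pM2l//.
by rewrite exprS invfM mulrCA divff ?mulr1// expf_neq0// gt_eqF.
Qed.

(* The left-hand side vanishes at v = 0 with slope - dl / 2, and it decays
   exponentially, whereas the right-hand side decays only like v^(-d/2). *)
Lemma gauss_ge (dl : R) : 0 < dl <= 1 -> exists2 C, 0 < C & forall v : R, 0 < v ->
  - expR (- v) + 2^-1 * expR (- (2 * v)) + 2^-1 * expR (- (dl * v)) <=
  C * (Num.sqrt v ^- d * expR (- (4 * v)^-1)).
Proof.
move=> /andP[dl0 dl1].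
have [K K0 HK] := exprn_le_expRM d dl0.
(* The exponential is the inverse of exp(- 1 / (4 v)) at the threshold v = dl / 5 of the case
   distinction below. *)
exists (K * expR (5 / (4 * dl))); first by rewrite mulr_gt0// expR_gt0.
move=> v v0.
have RHS0 : 0 <= K * expR (5 / (4 * dl)) * (Num.sqrt v ^- d * expR (- (4 * v)^-1)).
  by rewrite !mulr_ge0 ?expR_ge0 ?(ltW K0)// invr_ge0 exprn_ge0 ?sqrtr_ge0.
(* Second-order bounds make the left-hand side at most - dl v / 2 + 5 v^2 / 2, which is nonpositive
   exactly for v <= dl / 5. *)
have [vdl|vdl] := leP v (dl / 5).
  apply: le_trans RHS0.
  have h1 := expR_ge1Dx (- v).
  have h2 : 0 <= 2 * v by lra.
  have h3 : 0 <= dl * v by rewrite mulr_ge0// ltW.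
  have := expRN_le_quad h2; have := expRN_le_quad h3.
  have h4 : v ^+ 2 <= dl / 5 * v by rewrite expr2 ler_pM2r.
  have h5 : (dl * v) ^+ 2 <= v ^+ 2.
    rewrite exprMn ler_piMl ?exprn_ge0 ?(ltW v0)//.
    by rewrite exprn_ile1// ltW.
  rewrite [(2 * v) ^+ 2]exprMn; lra.
have sv : 0 < Num.sqrt v by rewrite sqrtr_gt0.
apply: (@le_trans _ _ (expR (- (dl * v)))).
  have : expR (- (2 * v)) <= expR (- (dl * v)).
    by rewrite ler_expR lerN2 ler_pM2r//; lra.
  by have := expR_gt0 (- v); lra.
have h1 : 1 <= expR (5 / (4 * dl)) * expR (- (4 * v)^-1).
  rewrite -expRD -[leLHS]expR0 ler_expR subr_ge0.
  rewrite (_ : 5 / (4 * dl) = (4 * (dl / 5))^-1); last by field; rewrite gt_eqF.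
  by rewrite lef_pV2 ?posrE ?mulr_gt0 ?divr_gt0// ler_pM2l// ltW.
have h2 : expR (- (dl * v)) <= K * Num.sqrt v ^- d.
  rewrite ler_pdivlMr ?exprn_gt0// expRN mulrC ler_pdivrMr ?expR_gt0//.
  apply: le_trans (HK _ (ltW v0)); rewrite lerXn2r ?nnegrE ?(ltW sv)//.
    by rewrite addr_ge0// ltW.
  by apply: sqrtr_le1D; exact: ltW.
rewrite mulrACA.
apply: (le_trans h2); rewrite ler_peMr// mulr_ge0 ?(ltW K0)//.
Qed.

(* The combination of gauss_ge after v is replaced by the stable symbol: its
   slope at r = 0 is 1 - 2^b / 2 - dl^b / 2, positive for small dl as b < 1. *)
Lemma powR_combination (b : R) : 0 < b < 1 -> exists dl sg : R,
  [/\ 0 < dl <= 1, 0 < sg <= 1 & forall r, 0 <= r <= sg ->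
   sg * r <= - expR (- r) + 2^-1 * expR (- (r * 2 `^ b)) + 2^-1 * expR (- (r * dl `^ b))].
Proof.
move=> /andP[b0 b1].
have p r : 0 < r -> 1 < 2 `^ r :> R.
  move=> r0; rewrite [ltLHS](_ : 1 = 1 `^ r); last by rewrite powR1.
  by apply: gt0_ltr_powR; rewrite ?nnegrE// ltr1n.
have p1 := p _ b0.
have p2 : 2 `^ b < 2 :> R.
  rewrite -subr_gt0 in b1; have := p _ b1.
  rewrite -(ltr_pM2l (powR_gt0 b (ltr0n R 2))) mulr1 -powRD ?pnatr_eq0 ?implybT//.
  by rewrite subrKC powRr1.
(* k = 1 - 2^b / 2 > 0, and dl is chosen with dl^b = k. The slope at 0 is then k - k / 2 = k / 2;
   the quadratic error r^2 <= (k / 4) r leaves sg = k / 4. *)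
pose k : R := (2 - 2 `^ b) / 2.
have k0 : 0 < k by rewrite divr_gt0// subr_gt0.
have k1 : k <= 1 by rewrite /k; lra.
exists (k `^ b^-1), (k / 4); split.
- rewrite powR_gt0//=; rewrite [leRHS](_ : 1 = 1 `^ b^-1); last by rewrite powR1.
  by apply: ge0_ler_powR; rewrite ?nnegrE ?invr_ge0 ?(ltW b0) ?(ltW k0).
- by rewrite divr_gt0//=; lra.
move=> r /andP[r0 rk].
rewrite -powRrM mulVf ?gt_eqF// powRr1 ?(ltW k0)//.
have h1 := expRN_le_quad r0.
have h2 := expR_ge1Dx (- (r * 2 `^ b)).
have h3 := expR_ge1Dx (- (r * k)).
have h4 : r ^+ 2 <= k / 4 * r by rewrite expr2 ler_wpM2r.
have : r * 2 `^ b = 2 * r - 2 * (r * k) by rewrite /k; field.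
lra.
Qed.

End gauss_inequalities.

Section regularized_density.
Context (R : realType) (d : nat) (b : R).
Hypothesis b01 : 0 < b < 1.
Local Notation lebd := (lebesgue_rV R d).

(* Up to the factor (2 pi)^d, the convolution of the stable density at time t
   with the Gaussian whose Fourier transform is exp(- e |xi|^2). *)
Definition regdens (e t : R) (x : 'rV[R]_d) : R :=
  \int[lebd]_xi (expR (- e * dotv xi xi) * cos (dotv xi x) *
                 expR (- t * dotv xi xi `^ b)).

Let gauss (v N : R) : R := Num.sqrt (pi / v) ^+ d * expR (- N / (4 * v)).

Let integrable_gausscos (e : R) (x : 'rV[R]_d) : 0 < e -> lebd.-integrable setT
  (EFin \o (fun xi => expR (- e * dotv xi xi) * cos (dotv xi x))).
Proof.
move=> e0; have := integrable_gauss_rV_cos x 0 e0.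
by congr (lebd.-integrable _ _); apply/funext => xi /=; rewrite addr0.
Qed.

Let RintegralE (v : R) (x : 'rV[R]_d) : 0 < v ->
  \int[lebd]_xi (expR (- v * dotv xi xi) * cos (dotv xi x)) = gauss v (dotv x x).
Proof.
move=> v0; rewrite /Rintegral.
under eq_integral => xi _ do rewrite -[dotv xi x]addr0.
by rewrite integral_gauss_rV_cos// cos0 mulr1.
Qed.

Lemma measurable_stable_symbol (t : R) :
  measurable_fun setT (fun xi : 'rV[R]_d => expR (- t * dotv xi xi `^ b)).
Proof.
apply: measurableT_comp => //; apply: measurable_funM => //.
apply: (measurableT_comp (measurable_powR _)); exact: measurable_dotv.
Qed.

Lemma stable_symbol_bounds (t l : R) : 0 <= t -> 0 <= expR (- t * l `^ b) <= 1.
Proof.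
by move=> t0; rewrite expR_ge0/= expR_le1 mulNr oppr_le0 mulr_ge0// powR_ge0.
Qed.

Lemma integrable_regdens (e t : R) (x : 'rV[R]_d) : 0 < e -> 0 <= t ->
  lebd.-integrable setT (EFin \o (fun xi => expR (- e * dotv xi xi) *
    cos (dotv xi x) * expR (- t * dotv xi xi `^ b))).
Proof.
move=> e0 t0; apply: integrable_dominated (integrable_gauss_rV _ e0) _.
  apply: measurable_funM; last exact: measurable_stable_symbol.
  by apply/measurable_EFinP; exact: measurable_int (integrable_gausscos x e0).
move=> xi; rewrite !normrM -mulrA ger0_norm ?expR_ge0// ler_piMr ?expR_ge0//.
have /andP[h0 h1] := stable_symbol_bounds (dotv xi xi) t0.
by rewrite (ger0_norm h0) mulr_ile1// cos_max.
Qed.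

(** [bernsteinP] for F l = exp(- t l^b) and the weight c exp(- e |xi|^2) cos(xi . x), integrable
    because e > 0. On F l = exp(- v l) the two exponentials merge and the integral is c times the
    Gaussian of parameter e + v. *)
Lemma regdens_comparison (c : R) (s : seq (R * R)) (e t : R) (x : 'rV[R]_d) :
  0 < e -> 0 <= t -> {in s, forall cl : R * R, 0 <= cl.2} ->
  (forall v, 0 <= v -> 0 <= \sum_(cl <- s) cl.1 * expR (- v * cl.2) +
    c * gauss (e + v) (dotv x x)) ->
  0 <= \sum_(cl <- s) cl.1 * expR (- t * cl.2 `^ b) + c * regdens e t x.
Proof.
move=> e0 t0 s0 h.
pose m xi := c * (expR (- e * dotv xi xi) * cos (dotv xi x)).
have im := integrableZl_EFin c (integrable_gausscos x e0).
have := bernsteinP (bernstein_expR_powR d t0 b01) s0 im.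
rewrite /regdens -RintegralZl//; last exact: integrable_regdens.
under [X in _ -> 0 <= _ + X]eq_Rintegral do rewrite mulrA.
apply => v v0.
under eq_Rintegral => xi _.
  rewrite -mulrA -mulrA [cos _ * _]mulrC [expR _ * (_ * _)]mulrA -expRD.
  rewrite -mulrDl -opprD; over.
have ev : 0 < e + v by rewrite ltr_wpDr.
rewrite RintegralZl//; last exact: integrable_gausscos.
by rewrite RintegralE//; exact: h.
Qed.

Let gaussE (N w : R) : 0 < N -> 0 < w -> gauss (N * w) N =
  Num.sqrt (pi / N) ^+ d * (Num.sqrt w ^- d * expR (- (4 * w)^-1)).
Proof.
move=> N0 w0; rewrite /gauss.
have -> : pi / (N * w) = pi / N * w^-1 by field; rewrite !gt_eqF.
rewrite sqrtrM ?divr_ge0 ?pi_ge0 ?(ltW N0)// sqrtrV ?(ltW w0)//.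
rewrite exprMn exprVn -mulrA; congr (_ * (_ * expR _)).
by field; rewrite !gt_eqF.
Qed.

Lemma regdens_ub : exists2 C, 0 < C & forall (e t : R) (x : 'rV[R]_d) (N : R),
  0 < e -> 0 <= t -> N = dotv x x -> 0 < N ->
  regdens e t x <= C * Num.sqrt (pi / N) ^+ d *
    (1 - expR (- (e / N)) * expR (- t * N^-1 `^ b)).
Proof.
have [C C0 HC] := gauss_le_1BexpR R d.
exists C => // e t x N e0 t0 NE N0.
pose A := C * Num.sqrt (pi / N) ^+ d.
(* The evaluation at 0 supplies the constant 1. [gauss_le_1BexpR] is used at (e + v) / N; of exp(-
   (e + v) / N) only the factor exp(- v / N) is transferred, so exp(- e / N) belongs to the
   coefficient. *)
have := @regdens_comparison (-1) [:: (A, 0); (- (A * expR (- (e / N))), N^-1)] e t x e0 t0.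
rewrite !big_cons big_nil addr0 /= powR0; last by case/andP: b01 => /gt_eqF->.
rewrite mulr0 expR0 mulr1 mulN1r subr_ge0 => h.
rewrite -/A mulrBr mulr1 mulrA -mulNr; apply: h => [cl|v v0].
  by rewrite !inE => /orP[/eqP->|/eqP->]//=; rewrite invr_ge0 ltW.
rewrite !big_cons big_nil addr0 /= mulr0 expR0 mulr1 mulN1r subr_ge0 -NE.
have ev : 0 < e + v by rewrite ltr_wpDr.
have w0 : 0 < (e + v) / N by rewrite divr_gt0.
have {1}-> : e + v = N * ((e + v) / N) by rewrite mulrCA divff ?mulr1// gt_eqF.
rewrite gaussE//.
apply: (@le_trans _ _ (Num.sqrt (pi / N) ^+ d * (C * (1 - expR (- ((e + v) / N)))))).
  by rewrite ler_wpM2l ?exprn_ge0 ?sqrtr_ge0// HC.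
rewrite le_eqVlt; apply/orP; left; apply/eqP.
rewrite (_ : - ((e + v) / N) = - (e / N) + - v * N^-1); last by field; rewrite gt_eqF.
by rewrite expRD /A; ring.
Qed.

Lemma regdens_lb (dl : R) : 0 < dl <= 1 ->
  exists2 c, 0 < c & forall (e t : R) (x : 'rV[R]_d) (N : R),
  0 < e -> 0 <= t -> 0 < N -> dotv x x <= N ->
  c * Num.sqrt (pi / N) ^+ d *
    (- (expR (- (e / N)) * expR (- t * N^-1 `^ b)) +
     2^-1 * (expR (- (2 * (e / N))) * expR (- t * (2 / N) `^ b)) +
     2^-1 * (expR (- (dl * (e / N))) * expR (- t * (dl / N) `^ b)))
  <= regdens e t x.
Proof.
move=> dl01; have [C C0 HC] := gauss_ge d dl01.
case/andP: dl01 => dl0 dl1.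
exists C^-1 => [|e t x N e0 t0 N0 xN]; first by rewrite invr_gt0.
pose A := C^-1 * Num.sqrt (pi / N) ^+ d.
have A0 : 0 <= A by rewrite mulr_ge0 ?invr_ge0 ?(ltW C0)// exprn_ge0 ?sqrtr_ge0.
have := @regdens_comparison 1 [:: (A * expR (- (e / N)), N^-1);
  (- (A * 2^-1 * expR (- (2 * (e / N)))), 2 / N);
  (- (A * 2^-1 * expR (- (dl * (e / N)))), dl / N)] e t x e0 t0.
rewrite !big_cons big_nil addr0 /= mul1r => h.
rewrite -/A -subr_ge0.
move: h; set q := regdens e t x.
set E1 := expR (- (e / N)); set E2 := expR (- (2 * (e / N))); set E3 := expR (- (dl * (e / N))).
move=> h; apply: le_trans (h _ _) _.
- move=> cl; rewrite !inE => /or3P[/eqP->|/eqP->|/eqP->]/=.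
  + by rewrite invr_ge0 ltW.
  + by rewrite divr_ge0// ltW.
  + by rewrite divr_ge0// ltW.
- move=> v v0; rewrite !big_cons big_nil addr0 /= mul1r.
  have ev : 0 < e + v by rewrite ltr_wpDr.
  have w0 : 0 < (e + v) / N by rewrite divr_gt0.
  (* The Gaussian decreases in |x|^2, so N may be any upper bound of |x|^2; [stable_lb] relies on
     this freedom. *)
  have hg : gauss (e + v) N <= gauss (e + v) (dotv x x).
    rewrite ler_wpM2l ?exprn_ge0 ?sqrtr_ge0// ler_expR !mulNr lerN2.
    by rewrite ler_pM2r// invr_gt0 mulr_gt0.
  have evE : e + v = N * ((e + v) / N) by rewrite mulrCA divff ?mulr1// gt_eqF.
  rewrite {1}evE gaussE// in hg.
  have hA : A * (- expR (- ((e + v) / N)) + 2^-1 * expR (- (2 * ((e + v) / N))) +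
      2^-1 * expR (- (dl * ((e + v) / N)))) <= gauss (e + v) (dotv x x).
    apply: le_trans hg; rewrite /A -mulrA [leLHS]mulrCA.
    rewrite ler_wpM2l ?exprn_ge0 ?sqrtr_ge0//.
    by rewrite ler_pdivrMl// HC.
  have F c : expR (- (c * ((e + v) / N))) = expR (- (c * (e / N))) * expR (- v * (c / N)).
    by rewrite -expRD; congr expR; field; rewrite gt_eqF.
  have F1 : expR (- ((e + v) / N)) = E1 * expR (- v * N^-1).
    by rewrite -expRD; congr expR; field; rewrite gt_eqF.
  rewrite !F F1 -/E2 -/E3 in hA.
  rewrite -subr_ge0 in hA; apply: le_trans hA _.
  by rewrite le_eqVlt; apply/orP; left; apply/eqP; ring.
by rewrite le_eqVlt; apply/orP; left; apply/eqP; ring.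
Qed.

End regularized_density.

(** * Two-sided bounds after removal of the Gaussian factor *)

Section two_sided_bounds.
Context (R : realType) (d : nat) (b : R).
Hypothesis b01 : 0 < b < 1.
Local Notation lebd := (lebesgue_rV R d).
Local Notation regdens := (@regdens R d b).
(** Later instantiated by (2 pi)^d p t x. Only the convergence of [regdens] matters for the
    bounds. *)
Variable L : R -> 'rV[R]_d -> R.
Hypothesis regdensL : forall t x, 0 < t ->
  regdens i.+1%:R^-1 t x @[i --> \oo] --> L t x.

Let b0 : 0 < b. Proof. by case/andP: b01. Qed.

Let cvg_exp_harmonic (c : R) : expR (- (c * i.+1%:R^-1)) @[i --> \oo] --> (1 : R).
Proof.
have h : expR (- (c * i.+1%:R^-1)) @[i --> \oo] --> expR (- (c * 0)).
  apply: continuous_cvg; first exact: continuous_expR.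
  by apply: cvgN; apply: cvgM; [exact: cvg_cst|exact: cvg_harmonic].
by rewrite mulr0 oppr0 expR0 in h.
Qed.

Let harmonic_gt0 i : 0 < i.+1%:R^-1 :> R. Proof. by rewrite invr_gt0. Qed.

Let L_le t x (g : R -> R) l : 0 < t ->
  (forall e, 0 < e -> regdens e t x <= g e) ->
  g i.+1%:R^-1 @[i --> \oo] --> l -> L t x <= l.
Proof.
move=> t0 h gl; apply: (ler_cvg_to (@regdensL t x t0) gl).
by apply: nearW => i; exact: h.
Qed.

Let L_ge t x (g : R -> R) l : 0 < t ->
  (forall e, 0 < e -> g e <= regdens e t x) ->
  g i.+1%:R^-1 @[i --> \oo] --> l -> l <= L t x.
Proof.
move=> t0 h gl; apply: (ler_cvg_to gl (@regdensL t x t0)).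
by apply: nearW => i; exact: h.
Qed.

Lemma off_diagonal_ub : exists2 C, 0 < C & forall (t : R) (x : 'rV[R]_d) (N : R),
  0 < t -> N = dotv x x -> 0 < N ->
  L t x <= C * Num.sqrt N ^- d * (t * N^-1 `^ b).
Proof.
have [C C0 HC] := regdens_ub d b01.
exists (C * Num.sqrt pi ^+ d) => [|t x N t0 NE N0].
  by rewrite mulr_gt0// exprn_gt0// sqrtr_gt0 pi_gt0.
have A0 : 0 <= C * Num.sqrt pi ^+ d * Num.sqrt N ^- d.
  by rewrite !mulr_ge0 ?(ltW C0) ?invr_ge0 ?exprn_ge0 ?sqrtr_ge0.
have h : L t x <= C * Num.sqrt (pi / N) ^+ d * (1 - 1 * expR (- t * N^-1 `^ b)).
  apply: (L_le t0 (fun e e0 => HC e t x N e0 (ltW t0) NE N0)).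
  apply: cvgM; first exact: cvg_cst.
  apply: cvgB; first exact: cvg_cst.
  apply: cvgM; last exact: cvg_cst.
  by under eq_fun do rewrite mulrC; exact: cvg_exp_harmonic.
apply: (le_trans h).
rewrite sqrtrM ?pi_ge0// sqrtrV ?(ltW N0)// exprMn exprVn mulrA ler_wpM2l// mul1r.
by have := expR_ge1Dx (- t * N^-1 `^ b); lra.
Qed.

(** As e tends to 0, [regdens_lb] leaves the expression of [powR_combination] at r = t N^(-b),
    because (2/N)^b = 2^b N^(-b) and likewise for dl. *)
Lemma off_diagonal_lb : exists c sg : R, [/\ 0 < c, 0 < sg <= 1 &
  forall (t : R) (x : 'rV[R]_d) (N : R), 0 < t -> 0 < N -> dotv x x <= N ->
  t * N^-1 `^ b <= sg -> c * Num.sqrt N ^- d * (t * N^-1 `^ b) <= L t x].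
Proof.
have [dl [sg [dl01 sg01 H]]] := powR_combination b01.
have [c c0 Hc] := regdens_lb d b01 dl01.
case/andP: (dl01) => dl0 dl1; case/andP: (sg01) => sg0 sg1.
exists (c * Num.sqrt pi ^+ d * sg), sg; split => //.
  by rewrite !mulr_gt0// exprn_gt0// sqrtr_gt0 pi_gt0.
move=> t x N t0 N0 xN tN.
have A0 : 0 <= c * Num.sqrt pi ^+ d * Num.sqrt N ^- d.
  by rewrite !mulr_ge0 ?(ltW c0) ?invr_ge0 ?exprn_ge0 ?sqrtr_ge0.
have h : c * Num.sqrt (pi / N) ^+ d *
    (- (1 * expR (- t * N^-1 `^ b)) + 2^-1 * (1 * expR (- t * (2 / N) `^ b)) +
     2^-1 * (1 * expR (- t * (dl / N) `^ b))) <= L t x.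
  apply: (L_ge t0 (fun e e0 => Hc e t x N e0 (ltW t0) N0 xN)).
  have cvg_term z : expR (- (z * (i.+1%:R^-1 / N))) @[i --> \oo] --> (1 : R).
    under eq_fun do rewrite mulrCA mulrC; exact: cvg_exp_harmonic.
  apply: cvgM; first exact: cvg_cst.
  apply: cvgD; first apply: cvgD.
  - apply: cvgN; apply: cvgM; last exact: cvg_cst.
    by under eq_fun do rewrite mulrC; exact: cvg_exp_harmonic.
  - apply: cvgM; first exact: cvg_cst.
    by apply: cvgM; [exact: cvg_term|exact: cvg_cst].
  - apply: cvgM; first exact: cvg_cst.
    by apply: cvgM; [exact: cvg_term|exact: cvg_cst].
apply: le_trans h.
rewrite sqrtrM ?pi_ge0// sqrtrV ?(ltW N0)// exprMn exprVn.
have -> : c * Num.sqrt pi ^+ d * sg / Num.sqrt N ^+ d * (t * N^-1 `^ b) =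
  c * Num.sqrt pi ^+ d / Num.sqrt N ^+ d * (sg * (t * N^-1 `^ b)) by ring.
rewrite [c * (_ / _)]mulrA ler_wpM2l// !mul1r.
have NI : 0 <= N^-1 by rewrite invr_ge0 ltW.
rewrite !powRM// ?(ltW dl0)//.
have F z : - t * (z * N^-1 `^ b) = - (t * N^-1 `^ b * z) by ring.
rewrite !F mulNr; apply: H; by rewrite tN andbT mulr_ge0 ?powR_ge0 ?(ltW t0).
Qed.

Lemma stable_le_diagonal (t : R) (x : 'rV[R]_d) : 0 < t -> L t x <= L t 0.
Proof.
move=> t0; apply: (ler_cvg_to (@regdensL t x t0) (@regdensL t 0 t0)).
apply: nearW => i; have e0 := harmonic_gt0 i.
apply: le_Rintegral => //.
- exact: (integrable_regdens b x e0 (ltW t0)).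
- exact: (integrable_regdens b 0 e0 (ltW t0)).
move=> xi _; rewrite dotv0 cos0 mulr1 ler_wpM2r ?expR_ge0// ler_piMr ?expR_ge0//.
Qed.

(** Substitution xi := c xi, with c chosen so that t c^(2b) = 1. At x = 0 the integrand is
    nonnegative, so the change of variables for nonnegative functions applies. *)
Let regdens0E (e t : R) : 0 < e -> 0 < t ->
  regdens e t 0 = (t `^ (- (2 * b)^-1)) ^+ d * regdens (e * t `^ (- (2 * b)^-1) ^+ 2) 1 0.
Proof.
move=> e0 t0; set c := t `^ _.
have c0 : 0 < c by rewrite powR_gt0.
have ct : t * (c ^+ 2) `^ b = 1.
  rewrite /c -powR_mulrn ?powR_ge0// -!powRrM.
  rewrite (_ : - (2 * b)^-1 * (2%:R * b) = -1); last by field; rewrite gt_eqF.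
  by rewrite powR_inv1 ?ltW// divff// gt_eqF.
pose f (e t : R) (xi : 'rV[R]_d) := (expR (- e * dotv xi xi) * cos (dotv xi 0) *
  expR (- t * dotv xi xi `^ b))%:E.
have f0 e' t' xi : (0 <= f e' t' xi)%E.
  by rewrite /f dotv0 cos0 mulr1 lee_fin mulr_ge0// expR_ge0.
have mf e' t' : measurable_fun setT (f e' t').
  apply/measurable_EFinP; apply: measurable_funM; last exact: measurable_stable_symbol.
  apply: measurable_funM.
    apply: measurableT_comp => //; apply: measurable_funM => //; exact: measurable_dotv.
  by under eq_fun do rewrite dotv0 cos0; exact: measurable_cst.
have := ge0_integral_affine_rV 0 c0 (mf e t) (f0 e t).
have -> : (\int[lebd]_x f e t (c *: x + 0)%R = \int[lebd]_x f (e * c ^+ 2)%R 1%R x)%E.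
  apply: eq_integral => xi _; rewrite /f addr0 dotvvZ !dotv0.
  congr (expR _ * _ * expR _)%:E; first by ring.
  rewrite powRM ?dotvv_ge0 ?sqr_ge0//.
  by rewrite mulNr mulrA ct mul1r mulN1r.
move=> /(congr1 fine); rewrite fineM//; last first.
  exact: integrable_fin_num (integrable_regdens b 0 e0 (ltW t0)).
have regE e' t' : fine (\int[lebd]_x f e' t' x)%E = regdens e' t' 0 by [].
by rewrite !regE => ->; rewrite mulrA divff ?mul1r// expf_neq0// gt_eqF.
Qed.

(** At x = 0 the integrand decreases in e, so each regularized value is at most the limit. The bound
    is uniform in e, hence indifferent to the rescaling of e in [regdens0E]. *)
Let regdens10_le (e : R) : 0 < e -> regdens e 1 0 <= L 1 0.
Proof.
move=> e0; apply: (cvgr_to_ge (@regdensL 1 0 ltr01)).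
have : i.+1%:R^-1 @[i --> \oo] --> (0 : R) by exact: cvg_harmonic.
move=> /cvgr_lt/(_ _ e0); apply: filterS => i ie.
apply: le_Rintegral => //.
- exact: (integrable_regdens b 0 e0 ler01).
- exact: (integrable_regdens b 0 (harmonic_gt0 i) ler01).
move=> xi _; rewrite dotv0 cos0 !mulr1 ler_wpM2r ?expR_ge0// ler_expR.
by rewrite !mulNr lerN2 ler_wpM2r ?dotvv_ge0// ltW.
Qed.

Let diagonal_ub (t : R) : 0 < t -> L t 0 <= (t `^ (- (2 * b)^-1)) ^+ d * L 1 0.
Proof.
move=> t0; apply: (L_le t0 (g := cst ((t `^ (- (2 * b)^-1)) ^+ d * L 1 0))); last exact: cvg_cst.
move=> e e0; rewrite regdens0E// ler_wpM2l ?exprn_ge0 ?powR_ge0//.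
by apply: regdens10_le; rewrite mulr_gt0// exprn_gt0// powR_gt0.
Qed.

(* The size of the stable density: t M^(-d/2-b) where M = max(|x|^2, t^(1/b)),
   that is, min(t^(-d/alpha), t/|x|^(d+alpha)) for b = alpha/2. *)
Definition stable_scale (t : R) (x : 'rV[R]_d) := Num.max (dotv x x) (t `^ b^-1).
Definition stable_size (t : R) (x : 'rV[R]_d) :=
  Num.sqrt (stable_scale t x) ^- d * (t * (stable_scale t x)^-1 `^ b).

Lemma stable_scale_gt0 t x : 0 < t -> 0 < stable_scale t x.
Proof. by move=> t0; rewrite /stable_scale lt_max powR_gt0// orbT. Qed.

Lemma stable_size_gt0 t x : 0 < t -> 0 < stable_size t x.
Proof.
move=> t0; have M0 := stable_scale_gt0 x t0.
by rewrite !mulr_gt0// ?invr_gt0 ?exprn_gt0 ?sqrtr_gt0 ?powR_gt0 ?invr_gt0.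
Qed.

Lemma stable_ub : exists2 C, 0 < C & forall t x, 0 < t -> L t x <= C * stable_size t x.
Proof.
have [C C0 HC] := off_diagonal_ub.
have [c [sg [c0 /andP[sg0 _] Hc]]] := off_diagonal_lb.
exists (Num.max C (Num.max 1 (L 1 0))) => [|t x t0]; first by rewrite lt_max C0.
have sz0 := ltW (stable_size_gt0 x t0).
have [xt|tx] := leP (t `^ b^-1) (dotv x x).
  have ME : stable_scale t x = dotv x x by rewrite /stable_scale max_l.
  have N0 : 0 < dotv x x by apply: lt_le_trans xt; exact: powR_gt0.
  apply: (le_trans (HC t x _ t0 erefl N0)).
  rewrite -mulrA -ME -/(stable_size t x) ler_wpM2r//.
  by rewrite le_max lexx.
have ME : stable_scale t x = t `^ b^-1 by rewrite /stable_scale max_r// ltW.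
(* In this regime t M^(-b) = 1, and what remains is M^(-d/2) = t^(-d/(2b)), the factor of
   [diagonal_ub]. *)
have szE : stable_size t x = (t `^ (- (2 * b)^-1)) ^+ d.
  rewrite /stable_size ME -powRN -powRrM mulNr mulVf ?gt_eqF// powR_inv1 ?ltW//.
  rewrite divff ?gt_eqF// mulr1 -exprVn -sqrtrV ?powR_ge0// -powR12_sqrt ?invr_ge0 ?powR_ge0//.
  rewrite -powRN -powRrM; congr (_ `^ _ ^+ _); field; rewrite gt_eqF//.
apply: (le_trans (stable_le_diagonal x t0)); apply: (le_trans (diagonal_ub t0)).
by rewrite szE mulrC ler_wpM2r ?exprn_ge0 ?powR_ge0// !le_max lexx !orbT.
Qed.

(** [off_diagonal_lb] with N = K M, where M is the scale and K^(-b) = sg. Since M >= t^(1/b), t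
    M^(-b) <= 1, so t N^(-b) <= sg holds for every x. *)
Lemma stable_lb : exists2 c, 0 < c & forall t x, 0 < t -> c * stable_size t x <= L t x.
Proof.
have [c [sg [c0 /andP[sg0 sg1] Hc]]] := off_diagonal_lb.
pose K := sg^-1 `^ b^-1.
have K1 : 1 <= K.
  rewrite /K [leLHS](_ : 1 = 1 `^ b^-1); last by rewrite powR1.
  by apply: ge0_ler_powR; rewrite ?nnegrE ?invr_ge0 ?(ltW b0) ?(ltW sg0)// invf_ge1.
have K0 : 0 < K by rewrite (lt_le_trans ltr01).
exists (c * Num.sqrt K ^- d * sg) => [|t x t0].
  by rewrite !mulr_gt0// invr_gt0 exprn_gt0// sqrtr_gt0.
have M0 := stable_scale_gt0 x t0.
set M := stable_scale t x in M0.
have Kb : K^-1 `^ b = sg.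
  by rewrite /K -powRN -powRrM mulNr mulVf ?gt_eqF// powR_inv1 ?invr_ge0 ?(ltW sg0)// invrK.
have KM0 : 0 < K * M by rewrite mulr_gt0.
have KME : t * (K * M)^-1 `^ b = sg * (t * M^-1 `^ b).
  by rewrite invfM powRM ?invr_ge0 ?(ltW K0) ?(ltW M0)// Kb mulrCA.
have tM : t * M^-1 `^ b <= 1.
  have tME : t `^ b^-1 <= M by rewrite /M /stable_scale le_max lexx orbT.
  have -> : M^-1 `^ b = (M `^ b)^-1.
    by rewrite -[M^-1](powR_inv1 (ltW M0)) -powRrM mulN1r powRN.
  rewrite ler_pdivrMr ?powR_gt0// mul1r.
  have : (t `^ b^-1) `^ b <= M `^ b.
    by apply: (ge0_ler_powR (ltW b0)); rewrite ?nnegrE ?powR_ge0 ?(ltW M0).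
  by rewrite -powRrM mulVf ?gt_eqF// powRr1// ltW.
have xM : dotv x x <= K * M.
  apply: (@le_trans _ _ M); first by rewrite /M /stable_scale le_max lexx.
  by rewrite ler_peMl// ltW.
have h : t * (K * M)^-1 `^ b <= sg by rewrite KME ler_piMr// ltW.
apply: le_trans (Hc t x _ t0 KM0 xM h).
rewrite KME sqrtrM ?(ltW K0)// exprMn invfM /stable_size -/M.
by rewrite le_eqVlt; apply/orP; left; apply/eqP; ring.
Qed.

End two_sided_bounds.

(** * The stable density and its transition kernel *)

Section approximate_identity.
Context (R : realType) (d : nat).
Local Notation lebd := (lebesgue_rV R d).

(** The Fourier transform of exp(- e |xi|^2), left unnormalized: its mass is (2 pi)^d, the source of
    that factor in front of p. *)
Definition heat (e : R) (z : 'rV[R]_d) : R :=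
  Num.sqrt (pi / e) ^+ d * expR (- dotv z z / (4 * e)).

Let heat_ge0 e z : 0 <= heat e z.
Proof. by rewrite mulr_ge0 ?expR_ge0// exprn_ge0// sqrtr_ge0. Qed.

Lemma measurable_heat d' (T : measurableType d') (e : R) (f : T -> 'rV[R]_d) :
  measurable_fun setT f -> measurable_fun setT (fun t => heat e (f t)).
Proof.
move=> mf; apply: measurable_funM => //; apply: measurableT_comp => //.
by apply: measurable_funM => //; apply: measurableT_comp => //; exact: measurable_dotv.
Qed.

Lemma ge0_integral_translation (f : 'rV[R]_d -> \bar R) (x : 'rV[R]_d) :
  measurable_fun setT f -> (forall z, 0 <= f z)%E ->
  (\int[lebd]_y f (y - x)%R = \int[lebd]_y f y)%E.
Proof.
move=> mf f0; have := ge0_integral_affine_rV (- x) ltr01 mf f0.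
by rewrite expr1n invr1 mul1e => <-; apply: eq_integral => y _; rewrite scale1r.
Qed.

Lemma integral_heat (e : R) (x : 'rV[R]_d) : 0 < e ->
  (\int[lebd]_y (heat e (x - y))%:E = ((2 * pi) ^+ d)%:E)%E.
Proof.
move=> e0.
transitivity (\int[lebd]_y (heat e (y - x))%:E)%E.
  by apply: eq_integral => y _; rewrite /heat -dotvvN opprB.
rewrite (ge0_integral_translation (f := fun z => (heat e z)%:E)) => [||z]; first last.
- by rewrite lee_fin.
- by apply/measurable_EFinP; exact: measurable_heat.
have v0 : 0 < (4 * e)^-1 by rewrite invr_gt0 mulr_gt0.
have heatE y : heat e y = Num.sqrt (pi / e) ^+ d * expR (- (4 * e)^-1 * dotv y y).
  by rewrite /heat; congr (_ * expR _); ring.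
under eq_integral do rewrite heatE EFinM.
rewrite ge0_integralZl//.
- rewrite integral_gauss_rV// -EFinM -exprMn -sqrtrM ?divr_ge0 ?pi_ge0 ?ltW//.
  congr (_ ^+ _)%:E; rewrite invrK (_ : pi / e * (pi * (4 * e)) = (2 * pi) ^+ 2).
    by rewrite sqrtr_sqr ger0_norm// mulr_ge0// pi_ge0.
  by field; rewrite gt_eqF.
- by apply: (measurable_int lebd); exact: integrable_gauss_rV.
Qed.

Lemma integrable_heat (e : R) (x : 'rV[R]_d) : 0 < e ->
  lebd.-integrable setT (EFin \o (fun y => heat e (x - y))).
Proof.
move=> e0; apply/integrableP; split.
  apply/measurable_EFinP; apply: measurable_heat; exact: measurable_sub_rV.
under eq_integral do rewrite /= ger0_norm ?heat_ge0//.
by rewrite integral_heat// ltry.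
Qed.

Lemma heat_le (e : R) (z : 'rV[R]_d) : 0 < e -> heat e z <= Num.sqrt (pi / e) ^+ d.
Proof.
move=> e0; rewrite ler_piMr ?exprn_ge0 ?sqrtr_ge0// expR_le1 mulNr oppr_le0.
by rewrite divr_ge0 ?dotvv_ge0// mulr_ge0// ltW.
Qed.

Lemma heat_far1 (e D : R) (z : 'rV[R]_d) : 0 < e -> D <= dotv z z ->
  heat e z <= Num.sqrt (pi / e) ^+ d * expR (- (D / (4 * e))).
Proof.
move=> e0 Dz; rewrite ler_wpM2l ?exprn_ge0 ?sqrtr_ge0// ler_expR mulNr lerN2.
by rewrite ler_pM2r// invr_gt0 mulr_gt0.
Qed.

(** Half of the exponent yields the small factor; the other half is kept as a heat kernel at 2 e,
    whose mass does not depend on e. *)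
Lemma heat_far2 (e D : R) (z : 'rV[R]_d) : 0 < e -> D <= dotv z z ->
  heat e z <= Num.sqrt 2 ^+ d * expR (- (D / (8 * e))) * heat (2 * e) z.
Proof.
move=> e0 Dz.
rewrite /heat mulrACA -exprMn -sqrtrM//.
have -> : 2 * (pi / (2 * e)) = pi / e by field; rewrite gt_eqF.
rewrite ler_wpM2l ?exprn_ge0 ?sqrtr_ge0// -expRD ler_expR.
have -> : - dotv z z / (4 * e) = - (dotv z z / (8 * e)) + - dotv z z / (4 * (2 * e)).
  by field; rewrite gt_eqF.
by rewrite lerD2r lerN2 ler_pM2r// invr_gt0 mulr_gt0.
Qed.

Lemma cvg_heat_far (c : R) : 0 < c ->
  Num.sqrt (pi / i.+1%:R^-1) ^+ d * expR (- (c / i.+1%:R^-1)) @[i --> \oo] --> (0 : R).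
Proof.
move=> c0; have c2 : 0 < c / 2 by rewrite divr_gt0.
have [K K0 HK] := exprn_le_expRM d c2.
apply: (@squeeze_cvgr _ _ _ _ (cst 0)
  (fun i => Num.sqrt pi ^+ d * K * expR (- (c / 2)) ^+ i.+1)).
- apply: nearW => i; rewrite mulr_ge0 ?exprn_ge0 ?sqrtr_ge0 ?expR_ge0//=.
  rewrite invrK sqrtrM ?pi_ge0// exprMn -!mulrA ler_wpM2l ?exprn_ge0 ?sqrtr_ge0//.
  rewrite -expRM_natr mulNr; set E := expR (- (c / 2 * _)).
  have -> : expR (- (c * i.+1%:R)) = E * E by rewrite -expRD; congr expR; field.
  rewrite mulrA ler_wpM2r ?expR_ge0// /E expRN ler_pdivrMr ?expR_gt0//.
  apply: le_trans (HK _ (ler0n _ _)); rewrite lerXn2r ?nnegrE ?sqrtr_ge0 ?addr_ge0//.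
  exact: sqrtr_le1D.
- exact: cvg_cst.
rewrite -(mulr0 (Num.sqrt pi ^+ d * K)); apply: cvgM; first exact: cvg_cst.
rewrite cvg_shiftS; apply: cvg_expr.
by rewrite ger0_norm ?expR_ge0// expR_lt1 oppr_lt0.
Qed.

(** f is integrable but not known to be bounded. Away from x, the uniform smallness of the kernel is
    therefore paired with |f y|, and its small mass with the constant |f x|. *)
Lemma approximate_identity (f : 'rV[R]_d -> R) (x : 'rV[R]_d) :
  lebd.-integrable setT (EFin \o f) -> continuous f ->
  \int[lebd]_y (f y * heat i.+1%:R^-1 (x - y)) @[i --> \oo] --> (2 * pi) ^+ d * f x.
Proof.
move=> intf cf.
have mf : measurable_fun setT f by apply/measurable_EFinP; exact: measurable_int intf.
pose k : R := (2 * pi) ^+ d.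
have k0 : 0 < k by rewrite exprn_gt0// mulr_gt0// pi_gt0.
pose F := \int[lebd]_y `|f y|.
apply/cvgrPdist_le => /= eps eps0.
pose eta := eps / (2 * k).
have eta0 : 0 < eta by rewrite divr_gt0// mulr_gt0.
have [dl dl0 Hdl] : exists2 dl, 0 < dl & forall y, dotv (x - y) (x - y) < dl ^+ 2 ->
    `|f y - f x| <= eta.
  have /cvgrPdist_le/(_ _ eta0) := cf x.
  move=> /nbhs_ballP[dl /= dl0 H]; exists dl => // y xy.
  rewrite distrC; apply: H; split => // i j.
  (* Balls of row vectors are those of the sup norm, and each coordinate is at most the Euclidean
     norm. *)
  rewrite (ord1 i) /ball/= -(@ltr_pXn2r _ 2)// ?nnegrE ?(ltW dl0)//.
  apply: le_lt_trans xy; rewrite real_normK ?num_real//.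
  rewrite /dotv (bigD1 j)//= !mxE -expr2 lerDl.
  by apply: sumr_ge0 => l _; rewrite -expr2 sqr_ge0.
pose A i : R := Num.sqrt (pi / i.+1%:R^-1) ^+ d * expR (- (dl ^+ 2 / 4 / i.+1%:R^-1)).
pose B i : R := Num.sqrt 2 ^+ d * expR (- (dl ^+ 2 / 8 / i.+1%:R^-1)).
have D0 : 0 < dl ^+ 2 by rewrite exprn_gt0.
have A0 : A i @[i --> \oo] --> (0 : R) by apply: cvg_heat_far; rewrite divr_gt0.
have B0 : B i @[i --> \oo] --> (0 : R).
  rewrite -(mulr0 (Num.sqrt 2 ^+ d)); apply: cvgM; first exact: cvg_cst.
  have -> : (fun i => expR (- (dl ^+ 2 / 8 / i.+1%:R^-1))) =
      (fun i => expR (- (dl ^+ 2 / 8)) ^+ i.+1).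
    by apply/funext => i; rewrite invrK -expRM_natr mulNr.
  rewrite (cvg_shiftS (fun i => expR (- (dl ^+ 2 / 8)) ^+ i)); apply: cvg_expr.
  by rewrite ger0_norm ?expR_ge0// expR_lt1 oppr_lt0 divr_gt0.
have h0 : A i * F + B i * `|f x| * k @[i --> \oo] --> (0 : R).
  rewrite -[X in _ --> X](_ : 0 * F + 0 * `|f x| * k = 0); last by rewrite !mul0r addr0.
  apply: cvgD; apply: cvgM => //; [exact: cvg_cst| |exact: cvg_cst].
  by apply: cvgM => //; exact: cvg_cst.
have eps2 : 0 < eps / 2 by rewrite divr_gt0.
move/cvgr_le : h0 => /(_ _ eps2); apply: filterS => i hi.
set e : R := i.+1%:R^-1.
have e0 : 0 < e by rewrite /e invr_gt0.
have e20 : 0 < 2 * e by rewrite mulr_gt0.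
have ih := integrable_heat x e0.
have ih2 := integrable_heat x e20.
have mh e' : measurable_fun setT (fun y : 'rV[R]_d => heat e' (x - y)).
  by apply: measurable_heat; exact: measurable_sub_rV.
have i1 : lebd.-integrable setT (EFin \o (fun y => f y * heat e (x - y))).
  apply: (integrable_dominated _ (integrableZl_EFin (Num.sqrt (pi / e) ^+ d)
    (integrable_abse intf))); first exact: measurable_funM.
  by move=> y; rewrite normrM mulrC ler_wpM2r// ger0_norm ?heat_le.
have i2 := integrableZl_EFin (f x) ih.
have Rheat e' : 0 < e' -> \int[lebd]_y heat e' (x - y) = k.
  by move=> ?; rewrite /Rintegral integral_heat.
have -> : k * f x = \int[lebd]_y (f x * heat e (x - y)).
  by rewrite RintegralZl// Rheat// mulrC.
rewrite -RintegralB//.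
have i3 : lebd.-integrable setT
    (EFin \o (fun y => f x * heat e (x - y) - f y * heat e (x - y))).
  exact: (integrableB measurableT i2 i1).
apply: (le_trans (le_normr_Rintegral measurableT i3)).
(* The first term dominates within distance dl of x and integrates to eps / 2. The other two come
   from [heat_far1] and [heat_far2], and their integral tends to 0. *)
pose G y := eta * heat e (x - y) + (A i * `|f y| + B i * `|f x| * heat (2 * e) (x - y)).
have iG1 := integrableZl_EFin eta ih.
have iG2 := integrableZl_EFin (A i) (integrable_abse intf).
have iG3 := integrableZl_EFin (B i * `|f x|) ih2.
have iG23 := integrableD_EFin iG2 iG3.
have iG : lebd.-integrable setT (EFin \o G) := integrableD_EFin iG1 iG23.
apply: (@le_trans _ _ (\int[lebd]_y G y)).
  apply: le_Rintegral => //; first exact: (integrable_abse i3).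
  move=> y _; rewrite /G -mulrBl normrM (ger0_norm (heat_ge0 _ _)) distrC.
  have A_ge0 : 0 <= A i by rewrite mulr_ge0 ?expR_ge0// exprn_ge0// sqrtr_ge0.
  have B_ge0 : 0 <= B i by rewrite mulr_ge0 ?expR_ge0// exprn_ge0// sqrtr_ge0.
  have [yD|Dy] := ltP (dotv (x - y) (x - y)) (dl ^+ 2).
    rewrite -[leLHS]addr0 lerD//; first by rewrite ler_wpM2r// Hdl.
    by rewrite addr_ge0// !mulr_ge0.
  rewrite -[leLHS]add0r lerD//; first by rewrite mulr_ge0// ltW.
  apply: (@le_trans _ _ (`|f y| * heat e (x - y) + `|f x| * heat e (x - y))).
    by rewrite -mulrDl ler_wpM2r// ler_normB.
  apply: lerD.
    rewrite mulrC ler_wpM2r// /A -/e -[_ / 4 / e]mulrA -invfM.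
    exact: heat_far1.
  rewrite mulrAC mulrC ler_wpM2r// /B -/e -[_ / 8 / e]mulrA -invfM.
  exact: heat_far2.
rewrite /G (RintegralD _ iG1 iG23)// (RintegralD _ iG2 iG3)//.
rewrite (RintegralZl _ _ ih)// (RintegralZl _ _ ih2)//.
rewrite (RintegralZl _ _ (integrable_abse intf))//.
rewrite !Rheat// -/F.
have -> : eps = eps / 2 + eps / 2 by field.
apply: lerD => //.
by rewrite /eta (_ : eps / (2 * k) * k = eps / 2)//; field; rewrite gt_eqF.
Qed.

End approximate_identity.

Section stable_density_limit.
Context (R : realType) (d : nat) (alpha : R) (p : R -> 'rV[R]_d -> R).
Hypothesis alpha02 : 0 < alpha < 2.
Hypothesis hp : is_stable_density alpha p.
Local Notation lebd := (lebesgue_rV R d).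
Local Notation b := (alpha / 2).

Lemma half_index : 0 < alpha / 2 < 1.
Proof. by case/andP: alpha02 => ? ?; apply/andP; split; lra. Qed.

Lemma enorm_powR (xi : 'rV[R]_d) : enorm xi `^ alpha = dotv xi xi `^ b.
Proof.
by rewrite /enorm -(powR12_sqrt (dotvv_ge0 xi)) -powRrM mulrC.
Qed.

Lemma stable_density_continuous t : 0 < t -> continuous (p t).
Proof. by move=> t0; have [sm _ _] := hp t0; have [] := sm [::]. Qed.

Lemma stable_density_integrable t : 0 < t ->
  lebd.-integrable setT (EFin \o p t).
Proof. by move=> t0; have [] := hp t0. Qed.

Lemma stable_density_cos t xi : 0 < t ->
  \int[lebd]_z (p t z * cos (dotv z xi)) = expR (- t * dotv xi xi `^ b).
Proof.
by move=> t0; have [_ _ /(_ xi)] := hp t0; rewrite /fourier enorm_powR => -[].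
Qed.

Lemma stable_density_sin t xi : 0 < t -> \int[lebd]_z (p t z * sin (dotv z xi)) = 0.
Proof. by move=> t0; have [_ _ /(_ xi)] := hp t0; rewrite /fourier => -[]. Qed.

Lemma stable_density_mass t : 0 < t -> (\int[lebd]_z (p t z)%:E = 1)%E.
Proof.
move=> t0; have := stable_density_cos 0 t0.
rewrite dotv0 powR0; last by case/andP: half_index => /gt_eqF->.
rewrite mulr0 expR0.
under eq_Rintegral do rewrite dotv0 cos0 mulr1.
rewrite /Rintegral => h; rewrite -[LHS]fineK; first by rewrite h.
exact: integrable_fin_num (stable_density_integrable t0).
Qed.

Let heat_fourier e (x : 'rV[R]_d) : 0 < e ->
  (\int[lebd]_xi (expR (- e * dotv xi xi) * cos (dotv xi x))%:E = (heat e x)%:E)%E.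
Proof.
move=> e0; under eq_integral => xi _ do rewrite -[dotv xi x]addr0.
by rewrite integral_gauss_rV_cos// cos0 mulr1.
Qed.

(** Regularized Fourier inversion: the integral of p t y exp(- e |xi|^2) cos(xi . (x - y)) over y
    and xi is computed in both orders. Absolute integrability uses |p t|, as the sign of p is not
    yet known. *)
Lemma regdens_conv e t x : 0 < e -> 0 < t ->
  regdens b e t x = \int[lebd]_y (p t y * heat e (x - y)).
Proof.
move=> e0 t0.
have ip := stable_density_integrable t0.
have mp : measurable_fun setT (p t) by apply/measurable_EFinP; exact: measurable_int ip.
pose F (yxi : 'rV[R]_d * 'rV[R]_d) : \bar R :=
  (p t yxi.1 * (expR (- e * dotv yxi.2 yxi.2) * cos (dotv yxi.2 (x - yxi.1))))%:E.
have mF : measurable_fun setT F.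
  apply/measurable_EFinP; apply: measurable_funM; first exact: measurableT_comp mp _.
  apply: measurable_funM.
    apply: measurableT_comp => //; apply: measurable_funM => //.
    exact: measurable_dotv.
  apply: measurableT_comp.
    by apply: continuous_measurable_fun; exact: continuous_cos.
  by apply: measurable_dotv => //; exact: measurable_sub_rV.
have iF : (lebd \x lebd)%E.-integrable setT F.
  apply/integrable12ltyP => //.
  apply: (@le_lt_trans _ _ (\int[lebd]_y (`|(p t y)%:E| * (Num.sqrt (pi / e) ^+ d)%:E))%E).
    apply: ge0_le_integral => //.
    - by move=> y _; exact: integral_ge0.
    - apply: (measurable_fun_fubini_tonelli_F (abse \o F)) => //=.
      exact: measurableT_comp.
    - apply: emeasurable_funM => //; apply: measurableT_comp => //.
      exact: measurable_int ip.
    move=> y _; rewrite -integral_gauss_rV// -ge0_integralZl//; last first.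
      exact: measurable_int (integrable_gauss_rV d e0).
    apply: ge0_le_integral => //.
    - by apply: measurableT_comp => //; exact: measurableT_comp mF _.
    - apply: emeasurable_funM => //.
      exact: measurable_int (integrable_gauss_rV d e0).
    move=> xi _; rewrite /F /= -EFinM lee_fin normrM ler_wpM2l//.
    by rewrite normrM (ger0_norm (expR_ge0 _)) ler_piMr ?expR_ge0// cos_max.
  rewrite ge0_integralZr//.
  - rewrite muleC lte_mul_pinfty//.
    by move/integrableP : ip => [].
  - by apply: measurableT_comp => //; exact: measurable_int ip.
have := Fubini iF.
have -> : (\int[lebd]_y \int[lebd]_xi F (y, xi) =
  \int[lebd]_y (p t y * heat e (x - y))%:E)%E.
  apply: eq_integral => y _; rewrite /F/=.
  under eq_integral do rewrite EFinM.
  rewrite integralZl//; first by rewrite heat_fourier.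
  have := integrable_gauss_rV_cos (x - y) 0 e0.
  by congr (lebd.-integrable _ _); apply/funext => xi /=; rewrite addr0.
have -> : (\int[lebd]_xi \int[lebd]_y F (y, xi) =
  \int[lebd]_xi (expR (- e * dotv xi xi) * cos (dotv xi x) *
     expR (- t * dotv xi xi `^ b))%:E)%E.
  apply: eq_integral => xi _; rewrite /F/=.
  have icos : lebd.-integrable setT (EFin \o (fun y => p t y * cos (dotv y xi))).
    apply: integrable_dominated (integrable_abse ip) _.
      apply: measurable_funM => //; apply: measurableT_comp.
        by apply: continuous_measurable_fun; exact: continuous_cos.
      exact: measurable_dotv.
    by move=> y /=; rewrite normrM ler_piMr// cos_max.
  have isin : lebd.-integrable setT (EFin \o (fun y => p t y * sin (dotv y xi))).
    apply: integrable_dominated (integrable_abse ip) _.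
      apply: measurable_funM => //; apply: measurableT_comp.
        by apply: continuous_measurable_fun; exact: continuous_sin.
      exact: measurable_dotv.
    by move=> y /=; rewrite normrM ler_piMr// sin_max.
  have i1 := integrableZl_EFin (expR (- e * dotv xi xi) * cos (dotv xi x)) icos.
  have i2 := integrableZl_EFin (expR (- e * dotv xi xi) * sin (dotv xi x)) isin.
  pose g y := expR (- e * dotv xi xi) * cos (dotv xi x) * (p t y * cos (dotv y xi)) +
    expR (- e * dotv xi xi) * sin (dotv xi x) * (p t y * sin (dotv y xi)).
  have ig : lebd.-integrable setT (EFin \o g) := integrableD_EFin i1 i2.
  transitivity (\int[lebd]_y (g y)%:E)%E.
    apply: eq_integral => y _; congr EFin.
    (* By the addition formula only the cosine and sine transforms of p t occur; the latter vanishes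
       since the Fourier transform is real. *)
    by rewrite /g dotvBr cosB (dotvC y xi); ring.
  rewrite -[LHS]fineK; last exact: integrable_fin_num ig.
  congr EFin; rewrite -[LHS]/(Rintegral lebd setT g) /g (RintegralD _ i1 i2)//.
  rewrite (RintegralZl _ _ icos)// (RintegralZl _ _ isin)//.
  by rewrite stable_density_cos// stable_density_sin// mulr0 addr0.
by rewrite /regdens /Rintegral => ->.
Qed.

Lemma cvg_regdens t x : 0 < t ->
  regdens b i.+1%:R^-1 t x @[i --> \oo] --> (2 * pi) ^+ d * p t x.
Proof.
move=> t0.
have -> : (fun i => regdens b i.+1%:R^-1 t x) =
    (fun i => \int[lebd]_y (p t y * heat i.+1%:R^-1 (x - y))).
  by apply/funext => i; rewrite regdens_conv ?invr_gt0.
apply: approximate_identity; first exact: stable_density_integrable.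
exact: stable_density_continuous.
Qed.

End stable_density_limit.

Section transition_density.
Context (R : realType) (d : nat) (alpha : R) (p : R -> 'rV[R]_d -> R).
Hypothesis alpha02 : 0 < alpha < 2.
Hypothesis hp : is_stable_density alpha p.
Local Notation lebd := (lebesgue_rV R d).
Local Notation b := (alpha / 2).
Local Notation size := (@stable_size R d b).

Let b01 := half_index alpha02.
Let k : R := (2 * pi) ^+ d.
Let k0 : 0 < k. Proof. by rewrite exprn_gt0// mulr_gt0// pi_gt0. Qed.
Let cvg_p t (x : 'rV[R]_d) : 0 < t ->
  regdens b i.+1%:R^-1 t x @[i --> \oo] --> k * p t x.
Proof. exact: cvg_regdens. Qed.

Lemma stable_density_bounds : exists c C : R, [/\ 0 < c, 0 < C &
  forall t x, 0 < t -> c * size t x <= p t x <= C * size t x].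
Proof.
have [C C0 HC] := stable_ub b01 cvg_p.
have [c c0 Hc] := stable_lb b01 cvg_p.
exists (k^-1 * c), (k^-1 * C); split; rewrite ?mulr_gt0 ?invr_gt0// => t x t0.
rewrite -!mulrA ler_pdivrMl// ler_pdivlMl//.
by rewrite HC// Hc.
Qed.

(** Positivity is a consequence of the lower bound, not part of the definition of the density. *)
Lemma stable_density_gt0 t x : 0 < t -> 0 < p t x.
Proof.
move=> t0; have [c [C [c0 C0 /(_ t x t0)/andP[h _]]]] := stable_density_bounds.
by apply: lt_le_trans h; rewrite mulr_gt0// stable_size_gt0.
Qed.

(** Evenness is inherited from [regdens], where it is that of the cosine, through uniqueness of
    limits. *)
Lemma stable_densityN t x : 0 < t -> p t (- x) = p t x.
Proof.
move=> t0; apply: (mulfI (lt0r_neq0 k0)).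
have h := @cvg_p t x t0; have hN := @cvg_p t (- x) t0.
have E : (fun i => regdens b i.+1%:R^-1 t (- x)) = (fun i => regdens b i.+1%:R^-1 t x).
  apply/funext => i; apply: eq_Rintegral => xi _.
  by rewrite -[- x]add0r dotvBr dotv0 add0r cosN.
by rewrite E in hN; exact: (cvg_unique _ hN h).
Qed.

(* The comparison functions satisfy a quasi-ultrametric inequality since the
   scale max(|x|^2, t^(1/b)) is subadditive up to a constant. *)
Lemma stable_size_min : exists2 K, 0 < K & forall s t (x y : 'rV[R]_d),
  0 < s -> 0 < t -> Num.min (size s x) (size t y) <= K * size (s + t) (x + y).
Proof.
have [b0 _] := andP b01.
(* 4 comes from |x + y|^2 <= 2 |x|^2 + 2 |y|^2, and 2^(1/b) from s + t <= 2 max(s, t). *)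
pose A : R := Num.max 4 (2 `^ b^-1).
have A0 : 0 < A by rewrite lt_max ltr0n.
pose K := Num.sqrt A ^+ d * A `^ b.
have K0 : 0 < K by rewrite mulr_gt0 ?powR_gt0// exprn_gt0// sqrtr_gt0.
have scaleP s t (x y : 'rV[R]_d) : 0 < s -> 0 < t ->
    stable_scale b (s + t) (x + y) <= A * Num.max (stable_scale b s x) (stable_scale b t y).
  move=> s0 t0; rewrite ge_max; apply/andP; split.
    apply: (le_trans (dotvvD_le x y)).
    set M := Num.max _ _.
    have xM : dotv x x <= M by rewrite /M /stable_scale !le_max lexx.
    have yM : dotv y y <= M by rewrite /M /stable_scale !le_max lexx !orbT.
    have M0 : 0 <= M by apply: le_trans xM; exact: dotvv_ge0.
    apply: (@le_trans _ _ (4 * M)); first by lra.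
    by rewrite ler_wpM2r// le_max lexx.
  have st : s + t <= 2 * Num.max s t.
    have : s <= Num.max s t by rewrite le_max lexx.
    have : t <= Num.max s t by rewrite le_max lexx orbT.
    lra.
  have m0 : 0 <= Num.max s t by rewrite le_max ltW.
  apply: (@le_trans _ _ ((2 * Num.max s t) `^ b^-1)).
    apply: ge0_ler_powR; rewrite ?nnegrE ?invr_ge0 ?(ltW b0) ?addr_ge0 ?(ltW s0) ?(ltW t0)//.
    by rewrite mulr_ge0.
  rewrite powRM//; apply: ler_pM; rewrite ?powR_ge0//; first by rewrite le_max lexx orbT.
  by have [st'|st'] := leP s t; rewrite /stable_scale !le_max lexx !orbT.
(* Applied to whichever of the two points has the larger scale, with z = x + y. *)
have key s t (x y : 'rV[R]_d) (z : 'rV[R]_d) : 0 < s -> 0 < t ->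
    stable_scale b (s + t) z <= A * stable_scale b s x -> size s x <= K * size (s + t) z.
  move=> s0 t0 h.
  have M0 := stable_scale_gt0 b x s0.
  have N0 : 0 < stable_scale b (s + t) z by apply: stable_scale_gt0; rewrite addr_gt0.
  rewrite /stable_size; set M := stable_scale b s x in h M0 *.
  set N := stable_scale b (s + t) z in h N0 *.
  have NM : M^-1 <= A * N^-1.
    by rewrite -[leLHS]mul1r ler_pdivrMr// mulrAC ler_pdivlMr// mul1r.
  have AN : 0 <= A * N^-1 by rewrite mulr_ge0 ?invr_ge0 ?(ltW A0) ?(ltW N0).
  have h1 : Num.sqrt M ^- d <= Num.sqrt A ^+ d * Num.sqrt N ^- d.
    rewrite -!exprVn -!sqrtrV ?(ltW M0) ?(ltW N0)// -exprMn -sqrtrM ?(ltW A0)//.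
    by rewrite lerXn2r ?nnegrE ?sqrtr_ge0// ler_sqrt.
  have h2 : s * M^-1 `^ b <= A `^ b * ((s + t) * N^-1 `^ b).
    rewrite mulrCA; apply: ler_pM; rewrite ?powR_ge0 ?(ltW s0) ?lerDl ?(ltW t0)//.
    rewrite -powRM ?(ltW A0) ?invr_ge0 ?(ltW N0)//.
    by apply: (ge0_ler_powR (ltW b0)); rewrite ?nnegrE ?invr_ge0 ?(ltW M0).
  rewrite /K mulrACA; apply: ler_pM => //.
  by rewrite mulr_ge0 ?powR_ge0 ?(ltW s0).
exists K => // s t x y s0 t0; rewrite ge_min.
have := scaleP s t x y s0 t0.
have [xy|xy] := leP (stable_scale b s x) (stable_scale b t y) => h.
  by rewrite [s + t]addrC in h *; rewrite (key t s y x)// orbT.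
by rewrite (key s t x y).
Qed.

(** A product equals minimum times maximum: the minimum is controlled by [stable_size_min], and the
    maximum is at most the sum. *)
Lemma stable_density_3P : exists2 C, 0 < C & forall s t (x y : 'rV[R]_d),
  0 < s -> 0 < t -> p s x * p t y <= C * p (s + t) (x + y) * (p s x + p t y).
Proof.
have [c [C [c0 C0 bnd]]] := stable_density_bounds.
have [K K0 HK] := stable_size_min.
exists (C * K / c) => [|s t x y s0 t0]; first by rewrite divr_gt0// mulr_gt0.
have st0 : 0 < s + t by rewrite addr_gt0.
have px := stable_density_gt0 x s0; have py := stable_density_gt0 y t0.
have /andP[_ sx] := bnd s x s0; have /andP[_ ty] := bnd t y t0.
have /andP[sty _] := bnd (s + t) (x + y) st0.
have hm : Num.min (p s x) (p t y) <= C * K / c * p (s + t) (x + y).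
  apply: (@le_trans _ _ (C * Num.min (size s x) (size t y))).
    rewrite ge_min; have [h|h] := leP (size s x) (size t y).
      by rewrite sx.
    by rewrite ty orbT.
  rewrite -[_ / c]mulrA -mulrA -[K / c * _]mulrA mulrA -mulrA ler_pM2l//.
  apply: (le_trans (HK s t x y s0 t0)); rewrite ler_pM2l// ler_pdivlMl//.
have -> : p s x * p t y = Num.min (p s x) (p t y) * Num.max (p s x) (p t y).
  by case: (leP (p s x) (p t y)) => h //; rewrite mulrC.
apply: ler_pM => //.
- by rewrite le_min !ltW.
- by rewrite le_max ltW.
- by rewrite ge_max lerDl lerDr !ltW.
Qed.

(** The definition gives regularity of p in space only, for each fixed time. Joint measurability is
    obtained from [regdens], an integral depending on parameters, and then passes to the limit p. *)
Lemma measurable_regdens (e : R) : 0 < e ->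
  measurable_fun setT (fun tx : R * 'rV[R]_d => regdens b e (Num.max tx.1 0) tx.2).
Proof.
move=> e0.
pose F (w : (R * 'rV[R]_d) * 'rV[R]_d) : \bar R :=
  (expR (- e * dotv w.2 w.2) * cos (dotv w.2 w.1.2) *
    expR (- Num.max w.1.1 0 * dotv w.2 w.2 `^ b))%:E.
have mF : measurable_fun setT F.
  have mq : measurable_fun setT
      (fun w : (R * 'rV[R]_d) * 'rV[R]_d => dotv w.2 w.2) by exact: measurable_dotv.
  apply/measurable_EFinP; apply: measurable_funM; first apply: measurable_funM.
  - apply: measurableT_comp => //; apply: measurable_funM => //.
  - apply: measurableT_comp.
      by apply: continuous_measurable_fun; exact: continuous_cos.
    by apply: measurable_dotv => //; apply: measurableT_comp.
  - apply: measurableT_comp => //; apply: measurable_funM.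
      apply: measurableT_comp => //; apply: measurable_maxr => //.
      by apply: measurableT_comp.
    by apply: (measurableT_comp (measurable_powR _)).
have -> : (fun tx : R * 'rV[R]_d => regdens b e (Num.max tx.1 0) tx.2) =
    (fun tx => fine (\int[lebd]_xi F^\+ (tx, xi) - \int[lebd]_xi F^\- (tx, xi))%E).
  apply/funext => tx; rewrite /regdens /Rintegral integralE.
  by congr (fine (_ - _)%E); apply: eq_integral => xi _; rewrite /F ?funeposE ?funenegE.
apply: measurableT_comp; first exact: (fine_measurable measurableT).
apply: emeasurable_funB.
  by apply: measurable_fun_fubini_tonelli_F => //; exact: measurable_funepos.
by apply: measurable_fun_fubini_tonelli_F => //; exact: measurable_funeneg.
Qed.

Lemma measurable_transition d' (T : measurableType d') (f g : T -> R)
    (u v : T -> 'rV[R]_d) :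
  measurable_fun setT f -> measurable_fun setT g ->
  measurable_fun setT u -> measurable_fun setT v ->
  measurable_fun setT (fun w => transition p (f w) (u w) (g w) (v w)).
Proof.
move=> mf mg mu mv.
pose P (tx : R * 'rV[R]_d) := if 0 < tx.1 then p tx.1 tx.2 else 0.
pose G i (tx : R * 'rV[R]_d) :=
  if 0 < tx.1 then k^-1 * regdens b i.+1%:R^-1 (Num.max tx.1 0) tx.2 else 0.
have mP : measurable_fun setT P.
  apply: (measurable_fun_cvg (h := G)) => [i|[t x] _].
    apply: measurable_fun_ifT => //.
      exact: measurable_fun_ltr.
    by apply: measurable_funM => //; apply: measurable_regdens; rewrite invr_gt0.
  rewrite /G /P /=; case: ifPn => [t0|_]; last exact: cvg_cst.
  rewrite max_l ?(ltW t0)// -[p t x](mulKf (lt0r_neq0 k0)).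
  by apply: cvgM; [exact: cvg_cst|exact: cvg_p].
have -> : (fun w => transition p (f w) (u w) (g w) (v w)) =
    (fun w => P (g w - f w, v w - u w)).
  by apply/funext => w; rewrite /transition /P /= subr_gt0.
apply: (measurableT_comp mP); apply: measurable_fun_pair.
  exact: measurable_funB.
exact: measurable_sub_rV.
Qed.

Lemma transition_ge0 s x t y : 0 <= transition p s x t y.
Proof.
rewrite /transition; case: ifPn => // st.
by rewrite ltW// stable_density_gt0// subr_gt0.
Qed.

Lemma transition_mass s t (x : 'rV[R]_d) : s < t ->
  (\int[lebd]_y (transition p s x t y)%:E = 1)%E.
Proof.
move=> st; rewrite /transition st.
have ts : 0 < t - s by rewrite subr_gt0.
rewrite -[RHS](stable_density_mass alpha02 hp ts).
apply: (ge0_integral_translation (f := fun z => (p (t - s) z)%:E)) => [|z].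
  exact: measurable_int (stable_density_integrable hp ts).
by rewrite lee_fin ltW// stable_density_gt0.
Qed.

Lemma transition_sym s x t y : transition p s x t y = transition p s y t x.
Proof.
rewrite /transition; case: ifPn => // st.
by rewrite -[y - x]opprB stable_densityN// subr_gt0.
Qed.

Lemma transition_3P : exists2 C, 0 < C & forall s x u z t y,
  transition p s x u z * transition p u z t y <=
  C * transition p s x t y * (transition p s x u z + transition p u z t y).
Proof.
have [C C0 HC] := stable_density_3P; exists C => // s x u z t y.
have RHS0 : 0 <= C * transition p s x t y * (transition p s x u z + transition p u z t y).
  by rewrite mulr_ge0 ?addr_ge0 ?transition_ge0// mulr_ge0 ?transition_ge0// ltW.
(* Unless s < u < t, one factor on the left is 0 by convention. *)
have [su|us] := ltP s u; last first.
  by rewrite {1}/transition ltNge us/= mul0r.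
have [ut|tu] := ltP u t; last first.
  by rewrite {2}/transition [u < t]ltNge tu/= mulr0.
move: RHS0; rewrite /transition su ut (lt_trans su ut) => _.
have h1 : 0 < u - s by rewrite subr_gt0.
have h2 : 0 < t - u by rewrite subr_gt0.
have := HC _ _ (z - x) (y - z) h1 h2.
by rewrite (addrC (u - s)) subrKA (addrC (z - x)) subrKA.
Qed.

End transition_density.

(** * Kato classes of a kernel satisfying the 3P inequality *)

Lemma cvge_at_right0P (R : realType) (f : R -> \bar R) :
  (forall h, 0 <= f h)%E ->
  f h @[h --> 0^'+] --> 0%E <->
  forall e : R, 0 < e -> exists2 h0 : R, 0 < h0 &
    forall h, 0 < h <= h0 -> (f h <= e%:E)%E.
Proof.
move=> f0; split => [/fine_cvgP[ffin fcvg] e e0|H].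
  move/cvgr_le : fcvg => /(_ _ e0) fe.
  have : \forall h \near 0^'+, (f h <= e%:E)%E.
    by near=> h; rewrite -[f h]fineK ?lee_fin; near: h.
  move=> [d /= d0 Hd]; exists (d / 2) => [|h /andP[h0 hd]]; first by rewrite divr_gt0.
  apply: Hd => //=; rewrite sub0r normrN gtr0_norm// (le_lt_trans hd)//.
  by rewrite ltr_pdivrMr// ltr_pMr// ltr1n.
have fle e : 0 < e -> \forall h \near 0^'+, (f h <= e%:E)%E.
  move=> e0; have [h0 h00 Hh0] := H _ e0.
  near=> h; apply: Hh0; apply/andP; split => //.
  by near: h; exact: nbhs_right_le.
apply/fine_cvgP; split.
  have := fle 1 ltr01; apply: filterS => h h1.
  by rewrite ge0_fin_numE// (le_lt_trans h1)// ltry.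
apply/cvgrPdist_le => /= e e0; have := fle e e0; apply: filterS => h he.
rewrite sub0r normrN ger0_norm ?fine_ge0//.
have hfin : f h \is a fin_num by rewrite ge0_fin_numE// (le_lt_trans he)// ltry.
by rewrite -lee_fin fineK.
Unshelve. all: end_near. Qed.

Section tonelli_on.
Context d1 d2 (T1 : measurableType d1) (T2 : measurableType d2) (R : realType).
Variables (m1 : {sigma_finite_measure set T1 -> \bar R})
  (m2 : {sigma_finite_measure set T2 -> \bar R}).
Local Open Scope ereal_scope.

Variables (D : set T1) (f : T1 * T2 -> \bar R).
Hypotheses (mD : measurable D) (mf : measurable_fun setT f) (f0 : forall z, 0 <= f z).

Let g := f \_ (fst @^-1` D).

Let mg : measurable_fun setT g.
Proof.
have mD' : measurable (fst @^-1` D : set (T1 * T2)).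
  by rewrite -[X in measurable X]setTI; exact: measurable_fst.
by apply/(measurable_restrictT _ mD'); exact: measurable_funTS.
Qed.

Let g0 z : 0 <= g z. Proof. by rewrite /g patchE; case: ifP. Qed.

Let memE (u : T1) (z : T2) : ((u, z) \in fst @^-1` D) = (u \in D).
Proof. by apply/idP/idP => /set_mem Du; exact: mem_set. Qed.

Let gE z : \int[m1]_u g (u, z) = \int[m1]_(u in D) f (u, z).
Proof.
by rewrite [RHS]integral_mkcond; apply: eq_integral => u _; rewrite /g !patchE memE.
Qed.

Lemma tonelli_on :
  \int[m1]_(u in D) \int[m2]_z f (u, z) = \int[m2]_z \int[m1]_(u in D) f (u, z).
Proof.
rewrite integral_mkcond; transitivity (\int[m1]_u \int[m2]_z g (u, z)).
  apply: eq_integral => u _; rewrite patchE; case: ifPn => uD.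
    by apply: eq_integral => z _; rewrite /g patchE memE uD.
  by rewrite integral0_eq// => z _; rewrite /g patchE memE (negbTE uD).
by rewrite fubini_tonelli//; apply: eq_integral => z _; rewrite gE.
Qed.

Lemma measurable_tonelli_on :
  measurable_fun setT (fun z => \int[m1]_(u in D) f (u, z)).
Proof.
rewrite -(funext gE); exact: (measurable_fun_fubini_tonelli_G g).
Qed.

End tonelli_on.

Section Kato_equivalence.
Context (R : realType) (d : nat).
Local Notation rV := 'rV[R]_d.
Local Notation leb1 := (@lebesgue_measure R).
Local Notation lebd := (lebesgue_rV R d).
Variable k : R -> rV -> R -> rV -> R.
Hypothesis k_ge0 : forall s x t y, 0 <= k s x t y.
Hypothesis measurable_k : forall d' (T : measurableType d') (f g : T -> R) (u v : T -> rV),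
  measurable_fun setT f -> measurable_fun setT g ->
  measurable_fun setT u -> measurable_fun setT v ->
  measurable_fun setT (fun w => k (f w) (u w) (g w) (v w)).
Hypothesis k_mass_fwd : forall s x t, s < t -> (\int[lebd]_y (k s x t y)%:E = 1)%E.
Hypothesis k_mass_bwd : forall s t y, s < t -> (\int[lebd]_x (k s x t y)%:E = 1)%E.
Variable C : R.
Hypothesis C0 : 0 < C.
Hypothesis k_3P : forall s x u z t y,
  k s x u z * k u z t y <= C * k s x t y * (k s x u z + k u z t y).
Local Open Scope ereal_scope.

Let fwd (q : R * rV -> R) h := ereal_sup [set (\int[lebd]_z
  \int[leb1]_(u in `[sx.1, (sx.1 + h)%R])
    (k sx.1 sx.2 u z * `|q (u, z)|)%:E) | sx in [set: R * rV]].

Let bwd (q : R * rV -> R) h := ereal_sup [set (\int[lebd]_z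
  \int[leb1]_(u in `[(ty.1 - h)%R, ty.1])
    (k u z ty.1 ty.2 * `|q (u, z)|)%:E) | ty in [set: R * rV]].

Let fwd_ge0 q h : 0 <= fwd q h.
Proof.
apply: le_trans (ereal_sup_ubound _); last by exists (0%R, 0%R).
apply: integral_ge0 => z _; apply: integral_ge0 => u _.
by rewrite lee_fin mulr_ge0.
Qed.

Let bwd_ge0 q h : 0 <= bwd q h.
Proof.
apply: le_trans (ereal_sup_ubound _); last by exists (0%R, 0%R).
apply: integral_ge0 => z _; apply: integral_ge0 => u _.
by rewrite lee_fin mulr_ge0.
Qed.

Let relative_at (q : R * rV -> R) (eta h : R) := forall x y s t, (s < t <= s + h)%R ->
  \int[leb1]_(u in `[s, t]) \int[lebd]_z (k s x u z * `|q (u, z)| * k u z t y)%:E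
  <= (eta * k s x t y)%:E.

Let eta_starP (q : R * rV -> R) : eta_star k (fun uz => `|q uz|%R) = 0 <->
  forall e : R, (0 < e)%R -> exists2 h : R, (0 < h)%R & relative_at q e h.
Proof.
split => [H e e0|H].
  have : eta_star k (fun uz => `|q uz|%R) < e%:E by rewrite H lte_fin.
  move=> /ereal_inf_lt[_ [eta [eta0 [h h0 rel]] <-]]; rewrite lte_fin => etae.
  exists h => // x y s t st; apply: le_trans (rel x y s t st) _.
  by rewrite lee_fin ler_wpM2r// ltW.
apply/eqP; rewrite eq_le; apply/andP; split.
  apply/lee_addgt0Pr => e e0; rewrite add0e; apply: ereal_inf_lbound.
  by exists e => //; split => //; have [h h0 rel] := H _ e0; exists h.
by apply: le_ereal_inf_tmp => _ [eta [eta0 _] <-]; rewrite lee_fin ltW.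
Qed.

Section q_fixed.
Variable q : R * rV -> R.
Hypothesis mq : measurable_fun [set: R * rV] q.

Let mfwd s x : measurable_fun setT (fun uz : R * rV => (k s x uz.1 uz.2 * `|q uz|)%:E).
Proof.
apply/measurable_EFinP; apply: measurable_funM; first exact: measurable_k.
exact: measurableT_comp.
Qed.

Let mbwd t y : measurable_fun setT (fun uz : R * rV => (k uz.1 uz.2 t y * `|q uz|)%:E).
Proof.
apply/measurable_EFinP; apply: measurable_funM; first exact: measurable_k.
exact: measurableT_comp.
Qed.

Let swap (D : set R) (f : R * rV -> \bar R) : measurable D ->
  measurable_fun setT f -> (forall z, 0 <= f z) ->
  \int[leb1]_(u in D) \int[lebd]_z f (u, z) =
  \int[lebd]_z \int[leb1]_(u in D) f (u, z).
Proof. exact: (@tonelli_on _ _ (measurableTypeR R) _ R leb1 lebd D f). Qed.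

Let le_integral_time (D D' : set R) (f : R * rV -> \bar R) :
  measurable D -> measurable D' -> D `<=` D' ->
  measurable_fun setT f -> (forall z, 0 <= f z) ->
  \int[leb1]_(u in D) \int[lebd]_z f (u, z) <=
  \int[leb1]_(u in D') \int[lebd]_z f (u, z).
Proof.
move=> mD mD' DD' mf f0; apply: ge0_subset_integral => //.
- apply: measurable_funTS.
  exact: (@measurable_fun_fubini_tonelli_F _ _ (measurableTypeR R) _ R lebd f).
- by move=> u _; exact: integral_ge0.
Qed.

Let fwd_ge h s x t : (t <= s + h)%R ->
  \int[leb1]_(u in `[s, t]) \int[lebd]_z (k s x u z * `|q (u, z)|)%:E <= fwd q h.
Proof.
move=> th; have f0 z : 0 <= (k s x z.1 z.2 * `|q z|)%:E by rewrite lee_fin mulr_ge0.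
apply: (le_trans (le_integral_time _ (measurable_itv `[s, (s + h)%R]) _ (mfwd s x) f0)) => //.
  by move=> u /=; rewrite !in_itv/= => /andP[-> /le_trans]; exact.
rewrite (swap (measurable_itv _) (mfwd s x) f0).
by apply: ereal_sup_ubound; exists (s, x).
Qed.

Let bwd_ge h s t y : (t <= s + h)%R ->
  \int[leb1]_(u in `[s, t]) \int[lebd]_z (k u z t y * `|q (u, z)|)%:E <= bwd q h.
Proof.
move=> th; have f0 z : 0 <= (k z.1 z.2 t y * `|q z|)%:E by rewrite lee_fin mulr_ge0.
apply: (le_trans (le_integral_time _ (measurable_itv `[(t - h)%R, t]) _ (mbwd t y) f0)) => //.
  move=> u /=; rewrite !in_itv/= => /andP[su ->]; rewrite andbT (le_trans _ su)//.
  by rewrite lerBlDr.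
rewrite (swap (measurable_itv _) (mbwd t y) f0).
by apply: ereal_sup_ubound; exists (t, y).
Qed.

(** The 3P inequality splits the integrand into a forward and a backward part, with C k(s,x,t,y) as
    a common factor that is constant in (u, z). *)
Let relative_of_parabolic (e h : R) : (0 <= e)%R ->
  fwd q h <= e%:E -> bwd q h <= e%:E -> relative_at q (C * (e + e)) h.
Proof.
move=> e0 fe be x y s t /andP[st th].
pose K := (C * k s x t y)%R.
have K0 : (0 <= K)%R by rewrite mulr_ge0// ltW.
pose f1 (z : R * rV) := (k s x z.1 z.2 * `|q z|)%:E.
pose f2 (z : R * rV) := (k z.1 z.2 t y * `|q z|)%:E.
have f10 z : 0 <= f1 z by rewrite lee_fin mulr_ge0.
have f20 z : 0 <= f2 z by rewrite lee_fin mulr_ge0.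
have mI f : measurable_fun setT f -> (forall z : R * rV, 0 <= f z) ->
    measurable_fun `[s, t] (fun u => \int[lebd]_z f (u, z)).
  move=> mf f0; apply: measurable_funTS.
  exact: (@measurable_fun_fubini_tonelli_F _ _ (measurableTypeR R) _ R lebd f).
have I0 f u : (forall z : R * rV, 0 <= f z) -> 0 <= \int[lebd]_z f (u, z).
  by move=> f0; exact: integral_ge0.
have m12 : measurable_fun setT (fun z => K%:E * (f1 z + f2 z)).
  by apply: emeasurable_funM => //; apply: emeasurable_funD; [exact: mfwd|exact: mbwd].
have f120 z : 0 <= K%:E * (f1 z + f2 z) by rewrite mule_ge0// adde_ge0.
apply: (@le_trans _ _ (\int[leb1]_(u in `[s, t]) \int[lebd]_z (K%:E * (f1 (u, z) + f2 (u, z))))).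
  have m3 : measurable_fun setT (fun z : R * rV => (k s x z.1 z.2 * `|q z| * k z.1 z.2 t y)%:E).
    apply/measurable_EFinP; apply: measurable_funM; last exact: measurable_k.
    by apply/measurable_EFinP; exact: mfwd.
  have f30 (z : R * rV) : 0 <= (k s x z.1 z.2 * `|q z| * k z.1 z.2 t y)%:E.
    by rewrite lee_fin !mulr_ge0.
  apply: ge0_le_integral => //=.
  - by move=> u _; exact: (I0 (fun z : R * rV => (k s x z.1 z.2 * `|q z| * k z.1 z.2 t y)%:E)).
  - exact: (mI _ m3 f30).
  - exact: (mI _ m12 f120).
  move=> u _; apply: ge0_le_integral => //=.
  - by move=> z _; exact: (f30 (u, z)).
  - exact: (measurableT_comp m3 (measurable_pair1 u)).
  - exact: (measurableT_comp m12 (measurable_pair1 u)).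
  move=> z _; rewrite /f1 /f2 -EFinD -EFinM lee_fin/= mulrAC -mulrDl mulrA.
  by rewrite ler_wpM2r.
rewrite [leRHS](_ : _ = K%:E * (e%:E + e%:E)); last first.
  by rewrite -EFinD -EFinM /K; congr EFin; ring.
under eq_integral => u _.
  rewrite ge0_integralZl//; last 2 first.
  - by apply: emeasurable_funD; [apply: measurableT_comp (mfwd s x) _|
      apply: measurableT_comp (mbwd t y) _]; exact: measurable_pair1.
  - by move=> z _; rewrite adde_ge0.
  rewrite ge0_integralD//; last 2 first.
  - exact: measurableT_comp (mfwd s x) (measurable_pair1 u).
  - exact: measurableT_comp (mbwd t y) (measurable_pair1 u).
  over.
rewrite ge0_integralZl//=; last 2 first.
- by apply: emeasurable_funD; apply: mI => //; [exact: mfwd|exact: mbwd].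
- by move=> u _; rewrite adde_ge0// I0.
rewrite lee_wpmul2l ?lee_fin// ge0_integralD//=; last 4 first.
- by move=> u _; exact: I0.
- by apply: mI => //; exact: mfwd.
- by move=> u _; exact: I0.
- by apply: mI => //; exact: mbwd.
apply: leeD; first exact: le_trans (fwd_ge x th) fe.
exact: le_trans (bwd_ge y th) be.
Qed.

(** w stands for the endpoint that is integrated out: y in the forward case and x in the backward
    one. Tonelli moves its integral outermost, where the relative inequality can be applied for each
    w. *)
Let integrate_out (D : set R) (F : (R * rV) * rV -> \bar R) (f : R * rV -> \bar R) :
  measurable D -> measurable_fun setT F -> (forall w, 0 <= F w) ->
  (forall u z, D u -> \int[lebd]_w F ((u, w), z) = f (u, z)) ->
  \int[leb1]_(u in D) \int[lebd]_z f (u, z) =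
  \int[lebd]_w \int[leb1]_(u in D) \int[lebd]_z F ((u, w), z).
Proof.
move=> mD mF F0 Ff.
rewrite -(swap mD (f := fun uw => \int[lebd]_z F (uw, z))); last 2 first.
- exact: (@measurable_fun_fubini_tonelli_F _ _ (measurableTypeR R * rV)%type _ R lebd F).
- by move=> uw; exact: integral_ge0.
apply: eq_integral => u /set_mem Du.
rewrite -(fubini_tonelli (fun zw : rV * rV => F ((u, zw.2), zw.1)))//.
  by apply: eq_integral => z _; rewrite Ff.
apply: (measurableT_comp mF); apply: measurable_fun_pair => //.
exact: measurable_fun_pair.
Qed.

Let le_integrate_out (D : set R) (F : (R * rV) * rV -> \bar R)
    (f : R * rV -> \bar R) (g : rV -> R) (e : R) :
  measurable D -> measurable_fun setT F -> (forall w, 0 <= F w) ->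
  (forall u z, D u -> \int[lebd]_w F ((u, w), z) = f (u, z)) ->
  measurable_fun setT g -> (forall w, 0 <= g w)%R -> \int[lebd]_w (g w)%:E = 1 ->
  (0 <= e)%R ->
  (forall w, \int[leb1]_(u in D) \int[lebd]_z F ((u, w), z) <= (e * g w)%:E) ->
  \int[leb1]_(u in D) \int[lebd]_z f (u, z) <= e%:E.
Proof.
move=> mD mF F0 Ff mg g0 g1 e0 Fg.
rewrite (integrate_out mD mF F0 Ff).
apply: (@le_trans _ _ (\int[lebd]_y (e%:E * (g y)%:E))); last first.
  rewrite ge0_integralZl//; first by rewrite g1 mule1.
  - exact/measurable_EFinP.
  - by move=> w _; rewrite lee_fin.
apply: ge0_le_integral => //=.
- by move=> w _; do 2 (apply: integral_ge0 => ? _).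
- apply: (@measurable_tonelli_on _ _ (measurableTypeR R) _ R leb1 D
    (fun uw => \int[lebd]_z F (uw, z))) => //.
    exact: (@measurable_fun_fubini_tonelli_F _ _ (measurableTypeR R * rV)%type _ R lebd F).
  by move=> uw; exact: integral_ge0.
- by apply/measurable_EFinP; exact: measurable_funM.
Qed.

Let measurable_time (f : R * rV -> \bar R) : measurable_fun setT f ->
  (forall z, 0 <= f z) -> measurable_fun setT (fun u => \int[lebd]_z f (u, z)).
Proof.
move=> mf f0; exact: (@measurable_fun_fubini_tonelli_F _ _ (measurableTypeR R) _ R lebd f).
Qed.

Let kqk s x t y (uz : R * rV) : \bar R :=
  (k s x uz.1 uz.2 * `|q uz| * k uz.1 uz.2 t y)%:E.

Let kqk_ge0 s x t y uz : 0 <= kqk s x t y uz.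
Proof. by rewrite lee_fin !mulr_ge0. Qed.

Let measurable_kqk d' (T : measurableType d') s t (x y : T -> rV) (u : T -> R) (z : T -> rV) :
  measurable_fun setT x -> measurable_fun setT y ->
  measurable_fun setT u -> measurable_fun setT z ->
  measurable_fun setT (fun w => kqk s (x w) t (y w) (u w, z w)).
Proof.
move=> mx my mu mz; apply/measurable_EFinP; apply: measurable_funM; last exact: measurable_k.
apply: measurable_funM; first exact: measurable_k.
apply: measurableT_comp => //; apply: (measurableT_comp mq).
exact: measurable_fun_pair.
Qed.

Let m11 : measurable_fun setT (fun w : (R * rV) * rV => w.1.1).
Proof. exact: measurableT_comp. Qed.

Let m12 : measurable_fun setT (fun w : (R * rV) * rV => w.1.2).
Proof. exact: measurableT_comp. Qed.

Let le_kqk s x t y (D : set R) : measurable D -> D `<=` `[s, t] ->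
  \int[leb1]_(u in D) \int[lebd]_z kqk s x t y (u, z) <=
  \int[leb1]_(u in `[s, t]) \int[lebd]_z kqk s x t y (u, z).
Proof.
move=> mD Dst; apply: (@le_integral_time D `[s, t] (kqk s x t y)) => //.
apply: (eq_measurable_fun (fun w => kqk s x t y (w.1, w.2))) => [[]//|].
by apply: (@measurable_kqk _ _ s t (fun=> x) (fun=> y) fst snd).
Qed.

Let fwd_of_relative (e h h' : R) : (0 <= e)%R -> (0 < h' <= h)%R ->
  relative_at q e h -> fwd q h' <= e%:E.
Proof.
move=> e0 /andP[h0 h'h] rel; apply: ge_ereal_sup => _ [[s x] _ <-]/=.
pose t := (s + h')%R; have st : (s < t)%R by rewrite /t ltrDl.
have f0 z : 0 <= (k s x z.1 z.2 * `|q z|)%:E by rewrite lee_fin mulr_ge0.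
(* The null point u = t is dropped, because k(u,z,t,.) has mass 1 only for u < t. *)
rewrite -(swap (measurable_itv _) (mfwd s x) f0) -/t -integral_itv_bndo_bndc; last first.
  by apply: measurable_funTS; exact: (measurable_time (mfwd s x) f0).
apply: (@le_integrate_out _ (fun w => kqk s x t w.1.2 (w.1.1, w.2))
  (fun uz => (k s x uz.1 uz.2 * `|q uz|)%:E) (k s x t)) => //.
- by apply: (@measurable_kqk _ _ s t (fun=> x) (fun w : (R * rV) * rV => w.1.2)
    (fun w => w.1.1) snd).
- move=> u z /=; rewrite in_itv/= => /andP[_ ut]; rewrite /kqk/=.
  under eq_integral do rewrite EFinM.
  rewrite ge0_integralZl//; first by rewrite k_mass_fwd// mule1.
  + by apply/measurable_EFinP; exact: measurable_k.
  + by move=> w _; rewrite lee_fin.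
  + by rewrite lee_fin mulr_ge0.
- exact: measurable_k.
- exact: k_mass_fwd.
move=> y; apply: (le_trans _ (rel x y s t _)); last by rewrite st/= lerD2l.
by apply: le_kqk => // u /=; rewrite !in_itv/= => /andP[-> /ltW].
Qed.

Let bwd_of_relative (e h h' : R) : (0 <= e)%R -> (0 < h' <= h)%R ->
  relative_at q e h -> bwd q h' <= e%:E.
Proof.
move=> e0 /andP[h0 h'h] rel; apply: ge_ereal_sup => _ [[t y] _ <-]/=.
pose s := (t - h')%R; have st : (s < t)%R by rewrite /s ltrBlDr ltrDl.
have f0 z : 0 <= (k z.1 z.2 t y * `|q z|)%:E by rewrite lee_fin mulr_ge0.
(* Here u = s is dropped instead, since k(s,.,u,z) has mass 1 only for s < u. *)
rewrite -(swap (measurable_itv _) (mbwd t y) f0) -/s -integral_itv_obnd_cbnd; last first.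
  by apply: measurable_funTS; exact: (measurable_time (mbwd t y) f0).
apply: (@le_integrate_out _ (fun w => kqk s w.1.2 t y (w.1.1, w.2))
  (fun uz => (k uz.1 uz.2 t y * `|q uz|)%:E) (fun x => k s x t y)) => //.
- by apply: (@measurable_kqk _ _ s t (fun w : (R * rV) * rV => w.1.2) (fun=> y)
    (fun w => w.1.1) snd).
- move=> u z /=; rewrite in_itv/= => /andP[su _]; rewrite /kqk/=.
  under eq_integral do rewrite -mulrA EFinM.
  rewrite ge0_integralZr//; first by rewrite k_mass_bwd// mul1e mulrC.
  + by apply/measurable_EFinP; exact: measurable_k.
  + by move=> w _; rewrite lee_fin.
  + by rewrite lee_fin mulr_ge0.
- exact: measurable_k.
- exact: k_mass_bwd.
move=> x; apply: (le_trans _ (rel x y s t _)).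
  by apply: le_kqk => // u /=; rewrite !in_itv/= => /andP[/ltW -> ->].
by rewrite st/= /s -addrA lerDl addrC subr_ge0.
Qed.

Lemma Kato_limits_equiv :
  (fwd q h @[h --> 0^'+] --> 0 /\ bwd q h @[h --> 0^'+] --> 0) <->
  eta_star k (fun uz => `|q uz|%R) = 0.
Proof.
split.
  move=> [fq bq]; apply/eta_starP => e e0.
  have Hf := (cvge_at_right0P (fwd_ge0 q)).1 fq.
  have Hb := (cvge_at_right0P (bwd_ge0 q)).1 bq.
  (* Chosen so that the constant C (e' + e') of [relative_of_parabolic] equals e. *)
  have e0' : (0 < e / (C + C))%R by rewrite divr_gt0// addr_gt0.
  have [h1 h10 Hh1] := Hf _ e0'; have [h2 h20 Hh2] := Hb _ e0'.
  have h0 : (0 < Num.min h1 h2)%R by rewrite lt_min h10.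
  exists (Num.min h1 h2) => //.
  rewrite (_ : e = (C * (e / (C + C) + e / (C + C)))%R); last first.
    by field; rewrite -mulr2n mulrn_eq0/= gt_eqF.
  apply: relative_of_parabolic; first exact: ltW.
    by apply: Hh1; rewrite h0 ge_min lexx.
  by apply: Hh2; rewrite h0 ge_min lexx orbT.
move=> /eta_starP H; split.
  apply: (cvge_at_right0P (fwd_ge0 q)).2 => e e0.
  have [h h0 rel] := H _ e0; exists h => // h' h'h.
  exact: fwd_of_relative (ltW e0) h'h rel.
apply: (cvge_at_right0P (bwd_ge0 q)).2 => e e0.
have [h h0 rel] := H _ e0; exists h => // h' h'h.
exact: bwd_of_relative (ltW e0) h'h rel.
Qed.

End q_fixed.

Lemma parabolic_relative_Kato : parabolic_Kato_class k = relative_Kato_class k.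
Proof.
apply/seteqP; split => q.
  by move=> [mq f b]; split; [exact: mq|exact: ((Kato_limits_equiv mq).1 (conj f b))].
move=> [mq e]; have [f b] := (Kato_limits_equiv mq).2 e.
by split; [exact: mq|exact: f|exact: b].
Qed.

End Kato_equivalence.

Theorem corollary11 (R : realType) (d : nat) (alpha : R)
    (p : R -> 'rV[R]_d -> R) :
  (1 <= d)%N -> 0 < alpha < 2 -> is_stable_density alpha p ->
  parabolic_Kato_class (transition p) = relative_Kato_class (transition p).
Proof.
move=> _ alpha02 hp.
have [C C0 p3P] := transition_3P alpha02 hp.
apply: (parabolic_relative_Kato _ _ _ _ C0 p3P).
- exact: (transition_ge0 alpha02 hp).
- by move=> d' T f g u v; exact: (measurable_transition hp).
- by move=> s x t; exact: (transition_mass alpha02 hp).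
(* Mass 1 in the starting point follows from mass 1 in the end point, as p is even. *)
- move=> s t y st; under eq_integral do rewrite (transition_sym hp).
  exact: (transition_mass alpha02 hp).
Qed.
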